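(* There exist universal numerical constants $c_1,c_2,C>0$ such that the following holds. Let $n\ge2$, $A\ge1$, let $\theta=(\theta_0,\dots,\theta_{n-1})\in[0,A]^n$ be a nonincreasing vector, let $\Pi^*$ be a permutation of $[n]$, and let $X=\Pi^*\cdot T(\theta)$. Let $Y=X+E$, where the entries of the $n\times n$ random matrix $E$ are independent, centered and subgaussian with subgaussian norm at most $1$. Let $\hat{\mathrm d}$ be the estimated distance built from $Y$ (defined in the context, with constant $c_1$), and let $\hat\Pi$ be the output of the procedure PINES (defined in the context) run on $\hat{\mathrm d}$ with $$\rho_3=\delta+\varepsilon,\qquad \rho_2=\alpha\delta+2(1+\alpha)\varepsilon,\qquad \rho_1=\alpha^2\delta+(2\alpha^2+3\alpha+2)\varepsilon,$$ where $\alpha=\sqrt2$, $\delta=\sqrt2A$ and $\varepsilon=c_2\big(A+\sqrt A\,(n\log n)^{1/4}\big)$. Then $$\mathbb E\big[\ell_2(\hat\Pi)\big]\le C\big(A\sqrt n+\sqrt A\,n^{3/4}\log^{1/4}(n)\big).$$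
   Context: $[n]=\{1,\dots,n\}$. $T(\theta)$ is the $n\times n$ symmetric Toeplitz matrix with $T(\theta)_{i,j}=\theta_{|i-j|}$. A permutation $\pi$ of $[n]$ is identified with its permutation matrix $\Pi$, and $\Pi\cdot M:=\Pi M\Pi^\top$, i.e. $(\Pi\cdot M)_{\pi(i),\pi(j)}=M_{i,j}$. A symmetric matrix $R\in\mathbb R^{n\times n}$ is Robinson if each row is unimodal with mode at its diagonal index: $R_{i,1}\le\dots\le R_{i,i}\ge\dots\ge R_{i,n}$ for each $i$; $\mathcal R_n$ is the set of such matrices. The loss is $\ell_2(\Pi)=\inf_{R\in\mathcal R_n}\|\Pi\cdot X-R\|_F$. A centered real variable $Z$ is subgaussian with norm at most $1$ if $\mathbb E e^{sZ}\le e^{s^2/2}$ for all $s\in\mathbb R$. Estimated distance. Let $Y_i$ be the $i$-th row of $Y$, $S_i=\sum_{j=1}^nY_{i,j}$, $\mathcal N_i=\{j\in[n]\setminus\{i\}:|S_j-S_i|\le c_1(A+\sqrt{n\log n})\}$, and $U_i=\max\{\langle Y_i,Y_j\rangle:j\in\mathcal N_i\}$ ($U_i=0$ if $\mathcal N_i=\emptyset$). For $i\ne j$, $\hat{\mathrm d}(i,j)=\sqrt{\max(0,\,U_i+U_j-2\langle Y_i,Y_j\rangle)}$, and $\hat{\mathrm d}(i,i)=0$. PINES with input $\hat{\mathrm d}$ and radii $\rho_1,\rho_2,\rho_3>0$: 1. Choose a maximal $\rho_1$-packing $\mathcal P\subset[n]$ for $\hat{\mathrm d}$, i.e. a subset,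 maximal for inclusion, with $\hat{\mathrm d}(i,j)>\rho_1$ for all distinct $i,j\in\mathcal P$, together with a partition $[n]=\bigsqcup_{i\in\mathcal P}P_i$ such that $i\in P_i\subset\{j:\hat{\mathrm d}(i,j)\le\rho_1\}$. 2. For each $i\in\mathcal P$, let $G_i$ be the graph with vertex set $\{j\in[n]:\hat{\mathrm d}(i,j)>\rho_2\}$ in which two distinct vertices $j,k$ are joined by an edge iff $\hat{\mathrm d}(j,k)\le\rho_3$. It is required that $\mathcal P\setminus\{i\}$ is contained in the union of at most two connected components of $G_i$; the traces of these components on $\mathcal P\setminus\{i\}$ are denoted $\mathcal C_i^-$ and $\mathcal C_i^+$, with $\mathcal C_i^+=\emptyset$ if $\mathcal P\setminus\{i\}$ lies in a single component (or is empty). 3. Choose $i_1\in\mathcal P$ with $\mathcal C_{i_1}^+=\emptyset$. Then for $k=2,\dots,|\mathcal P|$ recursively choose $i_k\in\mathcal P$ such that $\mathcal C^-_{i_k}$ or $\mathcal C^+_{i_k}$ equals $\{i_1,\dots,i_{k-1}\}$. 4. Output a permutation $\hat\Pi$ of $[n]$ ($\hat\Pi(j)$ is the rank of object $j$) that ranks all elements of $P_{i_1}$ first, then all elements of $P_{i_2}$, and so on, the order inside each $P_{i_k}$ being arbitrary. If some required choice is impossible, the output is an arbitrary fixed permutation. Arbitrary choices are made by any fixed deterministic (measurable) rule. *)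

(* Defs.v *)
(* MathComp / MathComp-Analysis; the reals are an arbitrary R : realType. *)
From HB Require Import structures.
From mathcomp Require Import all_boot all_order all_algebra all_fingroup.
From mathcomp Require Import all_classical all_reals all_analysis.

Set Implicit Arguments.
Unset Strict Implicit.
Unset Printing Implicit Defensive.

Import Order.TTheory GRing.Theory Num.Theory.
Local Open Scope ring_scope.

Section Matrices.
Context {R : realType} {n : nat}.
Implicit Types (M X Y : 'M[R]_n) (s : {perm 'I_n}).

Definition toeplitz (theta : n.-tuple R) : 'M[R]_n :=
  \matrix_(i, j) theta`_(absz (i%:Z - j%:Z)).

Definition perm_act s M : 'M[R]_n :=
  \matrix_(i, j) M ((s^-1)%g i) ((s^-1)%g j).

Lemma perm_actE s M i j : perm_act s M (s i) (s j) = M i j.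
Proof. by rewrite mxE !permK. Qed.

(* With the MathComp convention (perm_mx s) i j = (s i == j), the matrix Pi
   of s in Pi M Pi^T, which has Pi (s i) i = 1, is perm_mx s^-1. *)
Lemma perm_act_mulmx s M :
  perm_act s M = perm_mx s^-1 *m M *m (perm_mx s^-1)^T.
Proof.
by rewrite -row_permE tr_perm_mx -col_permE; apply/matrixP=> i j; rewrite !mxE.
Qed.

Definition frob_norm M : R := Num.sqrt (\sum_i \sum_j M i j ^+ 2).

Definition robinson : set 'M[R]_n := fun Q =>
  [/\ Q^T = Q,
      forall i j k : 'I_n, (j <= k)%N -> (k <= i)%N -> Q i j <= Q i k
    & forall i j k : 'I_n, (i <= j)%N -> (j <= k)%N -> Q i k <= Q i j].

Definition ell2 X s : R :=
  inf [set frob_norm (perm_act s X - Q) | Q in robinson]%classic.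

Definition mx_measurable : set (set 'M[R]_n) :=
  (<<s \bigcup_(ij in [set: 'I_n * 'I_n])
         preimage_set_system setT (fun M : 'M[R]_n => M ij.1 ij.2)
           measurable >>)%classic.

End Matrices.

Section EstimatedDistance.
Context {R : realType} {n : nat}.
Variables (c1 A : R) (Y : 'M[R]_n).

Definition row_inner (i j : 'I_n) : R := \sum_k Y i k * Y j k.

Definition row_total (i : 'I_n) : R := \sum_j Y i j.

Definition candidates (i : 'I_n) : {set 'I_n} :=
  [set j | (j != i) &&
     (`|row_total j - row_total i| <=
        c1 * (A + Num.sqrt (n%:R * ln n%:R)))].

(* The maximum is seeded with the value at some candidate j0 rather than
   with 0, as all the inner products may be negative. *)
Definition self_inner (i : 'I_n) : R :=
  if [pick j in candidates i] is Some j0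
  then \big[Num.max/row_inner i j0]_(j in candidates i) row_inner i j
  else 0.

Definition dhat : 'M[R]_n :=
  \matrix_(i, j)
    if i == j then 0
    else Num.sqrt (Num.max 0
           (self_inner i + self_inner j - 2 * row_inner i j)).

End EstimatedDistance.

Section Pines.
Context {R : realType} {n : nat}.
Variables (d : 'M[R]_n) (rho1 rho2 rho3 : R).
Implicit Types (i j k : 'I_n) (S : {set 'I_n}) (s : seq 'I_n).
Implicit Types (B Cm Cp : 'I_n -> {set 'I_n}).

Definition is_packing S : bool :=
  [forall i in S, forall j in S, (i != j) ==> (rho1 < d i j)].

Definition is_cells S B : Prop :=
  [/\ \bigcup_(i in S) B i = [set: 'I_n]%SET,
      {in S &, forall i j, i != j -> [disjoint B i & B j]}
    & {in S, forall i, i \in B i /\ B i \subset [set j | d i j <= rho1]}].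

Definition far i : {set 'I_n} := [set j | rho2 < d i j].

Definition edge i : rel 'I_n :=
  fun j k => [&& j \in far i, k \in far i, j != k & d j k <= rho3].

Definition components i : {set {set 'I_n}} :=
  equivalence_partition (connect (edge i)) (far i).

(* Cm, Cp are admissible values of C_i^-, C_i^+; no such pair exists when
   the requirement on G_i fails.  When two components are needed, either
   one may be labelled "minus". *)
Definition is_traces S i (Cm Cp : {set 'I_n}) : Prop :=
  let Q := S :\ i in
  if (Q == finset.set0) || [exists K in components i, Q \subset K]
  then Cm = Q /\ Cp = finset.set0
  else exists Km Kp, [/\ Km \in components i, Kp \in components i,
         Q \subset Km :|: Kp, Cm = Km :&: Q & Cp = Kp :&: Q].

Definition eligible S Cm Cp s i : bool :=
  (i \in S) &&
  (if s is [::] then Cp i == finset.set0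
   else (Cm i == [set j in s]) || (Cp i == [set j in s])).

Inductive chain S Cm Cp : seq 'I_n -> Prop :=
| chain_nil : chain S Cm Cp [::]
| chain_rcons s i :
    chain S Cm Cp s -> eligible S Cm Cp s i -> chain S Cm Cp (rcons s i).

Definition ranks_blocks B s (p : {perm 'I_n}) : bool :=
  pairwise (fun i i' => [forall j in B i, forall k in B i', (p j < p k)%N]) s.

(* pines p0 p: some run of the procedure, over all its arbitrary choices,
   outputs p; p0 is the fallback output when a choice is impossible.  A
   maximal packing always exists, and so do the cells when d is symmetric
   with zero diagonal and 0 <= rho1, so only later steps may fail. *)
Inductive pines (p0 : {perm 'I_n}) : {perm 'I_n} -> Prop :=
| pines_disconnected S B i of
    maxset is_packing S & is_cells S B & i \in S
    & (forall Cm Cp : {set 'I_n}, ~ is_traces S i Cm Cp) :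
    pines p0 p0
| pines_stuck S B Cm Cp s of
    maxset is_packing S & is_cells S B
    & {in S, forall i, is_traces S i (Cm i) (Cp i)}
    & chain S Cm Cp s & (size s < #|S|)%N
    & (forall i, ~~ eligible S Cm Cp s i) :
    pines p0 p0
| pines_done S B Cm Cp s p of
    maxset is_packing S & is_cells S B
    & {in S, forall i, is_traces S i (Cm i) (Cp i)}
    & chain S Cm Cp s & size s = #|S| & ranks_blocks B s p :
    pines p0 p.

End Pines.

Section Probability.
Context d {T : measurableType d} {R : realType} (P : probability T R).

Definition mutually_independent (I : finType) (Z : I -> {RV P >-> R}) : Prop :=
  forall (J : {set I}) (B : I -> set R), (forall i, measurable (B i)) ->
    P (\bigcap_(i in [set` J]) (Z i @^-1` B i))%classic
    = (\prod_(i in J) P (Z i @^-1` B i)%classic)%E.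

Definition centered (Z : {RV P >-> R}) : Prop :=
  P.-integrable setT (EFin \o Z) /\ 'E_P[Z]%E = 0%E.

Definition subgaussian1 (Z : {RV P >-> R}) : Prop :=
  forall s : R, ('M_P Z s <= (expR (s ^+ 2 / 2))%:E)%E.

End Probability.

(* Main.v *)
(* Let D(i,j) be the Euclidean distance between the rows i and j of X. Because
   X is, up to reordering, Toeplitz with nonincreasing profile, D satisfies
   D(i,j), D(j,k) <= sqrt 2 * D(i,k) when j lies between i and k, and D is at
   most sqrt 2 * A on neighbours. The squared norm of a row changes by at most
   2 A times the change of its sum, so no row with nearly the same sum is much
   longer, while a neighbouring row has <X_i,X_j> >= |X_i|^2 - O(A^2); thus U_i
   estimates |X_i|^2, and |dhat - D| <= eps as
   soon as all row sums of E and all products <X_i,E_j>, <E_i,E_j> (i <> j) are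
   of order A sqrt (n log n).
   On that event no edge of G_i joins the two sides of i, while all points of
   the packing on one side of i are connected; thus C_i^- and C_i^+ are the two
   sides, and PINES orders the cells as the latent order or its reverse. If
   the rank of an object u exceeds its latent position, then by pigeonhole some
   object w ranked before u lies, in the latent order, at or beyond that rank;
   as cells are ordered and have radius rho1, D(u,w) = O(rho1), hence D between
   u and the object whose latent position is the rank of u is O(rho1), and the
   loss is O(sqrt n * rho1).
   The exceptional event is absorbed in the bound
   loss <= K + n A W, where W is a sum of Chernoff exponentials with E W <= 1/n.
   For <E_i,E_j>, integrating out E_i leaves exp (s^2 |E_j|^2 / 2), whose mean
   is controlled by the Taylor series and the moments of E_j. *)
Require Import Defs.
From HB Require Import structures.
From mathcomp Require Import all_boot all_order all_algebra all_fingroup.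
From mathcomp Require Import all_classical all_reals all_analysis.
From mathcomp Require Import measurable_realfun.
From mathcomp Require Import ring lra zify.

Set Implicit Arguments.
Unset Strict Implicit.
Unset Printing Implicit Defensive.

Import Order.TTheory GRing.Theory Num.Theory.
Local Open Scope ring_scope.

(** * Decoupling an independent variable from the others *)

Section Decoupling.
Local Open Scope classical_set_scope.
Local Open Scope ereal_scope.
Context d (T : measurableType d) (R : realType) (P : probability T R).
Context (I : finType) (Z : I -> {RV P >-> R}).
Hypothesis indep : mutually_independent Z.

Definition cylinders (J : {set I}) : set (set T) :=
  [set C | exists2 B : I -> set R, (forall i, measurable (B i)) &
           C = \bigcap_(i in [set` J]) (Z i @^-1` B i)].

Lemma bigcap_finset_measurable (J : {set I}) (F : I -> set T) :
  (forall i, measurable (F i)) -> measurable (\bigcap_(i in [set` J]) F i).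
Proof. by move=> mF; apply: fin_bigcap_measurable => // i _; exact: mF. Qed.

Lemma cylinders_measurable J : cylinders J `<=` measurable.
Proof.
move=> _ [B mB ->]; apply: bigcap_finset_measurable => i.
by rewrite -[X in measurable X]setTI; exact: measurable_funP.
Qed.

Lemma sigma_cylinders_measurable J : <<s cylinders J >> `<=` measurable.
Proof.
exact: smallest_sub (@sigma_algebra_measurable _ T) (@cylinders_measurable J).
Qed.

Lemma cylinders_setI J : setI_closed (cylinders J).
Proof.
move=> _ _ [B mB ->] [B' mB' ->]; exists (fun i => B i `&` B' i).
  by move=> i; exact: measurableI.
by rewrite -bigcapI; apply: eq_bigcapr => i _; rewrite preimage_setI.
Qed.

Lemma cylinders_setT J : cylinders J setT.
Proof.
by exists (fun=> setT) => //; rewrite bigcapT.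
Qed.

(* [T] with the sigma-algebra generated by the [Z i] for [i] in [J]. *)
Definition past (J : {set I}) : measurableType _ :=
  g_sigma_algebraType (cylinders J).

Lemma past_RV (J : {set I}) (i : I) : i \in J ->
  measurable_fun [set: past J] (Z i : past J -> R).
Proof.
move=> iJ _ B mB; rewrite setTI; apply: sub_sigma_algebra.
exists (fun j => if j == i then B else setT); first by move=> j; case: ifP.
apply/seteqP; split => [w Bw j _|w /(_ i iJ)] /=; last by rewrite eqxx.
by case: eqP => [->|].
Qed.

Lemma past_measurable (J : {set I}) d' (T' : measurableType d') (f : T -> T') :
  measurable_fun [set: past J] (f : past J -> T') -> measurable_fun [set: T] f.
Proof.
move=> mf _ B mB; rewrite setTI; apply: (@sigma_cylinders_measurable J).
by rewrite -[X in _ X]setTI; exact: mf.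
Qed.

(** With [A] fixed, both sides are finite measures in [C]. Independence makes them agree on the
    cylinders over [J], a pi-system containing the whole space, hence on the generated
    sigma-algebra. *)
Lemma indep_past (J : {set I}) i (A : set R) (C : set T) : i \notin J ->
  measurable A -> <<s cylinders J >> C ->
  P (Z i @^-1` A `&` C) = P (Z i @^-1` A) * P C.
Proof.
move=> iJ mA sC.
have mZA : measurable (Z i @^-1` A).
  by rewrite -[X in measurable X]setTI; exact: measurable_funP.
have c0 : (0 <= fine (P (Z i @^-1` A)))%R by exact: fine_ge0.
pose m1 : {measure set T -> \bar R} := mrestr P mZA.
pose m2 : {measure set T -> \bar R} := mscale (NngNum c0) P.
have := @g_sigma_algebra_measure_unique _ R T (cylinders J)
  (@cylinders_measurable J) (fun=> setT) (fun=> cylinders_setT J) _ m1 m2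
  (@cylinders_setI J) _ _ C sC.
rewrite /m1 /m2 /= /mrestr /mscale /= fineK ?fin_num_measure// => eqm; rewrite setIC eqm//.
- exact: bigcup_const.
- move=> _ [B mB ->].
  (* The event on [Z i] and the cylinder over [J] together form one cylinder over [i |: J]. *)
  pose B' j := if j == i then A else B j.
  have mB' j : measurable (B' j) by rewrite /B'; case: ifP.
  have eqB' j : j \in J -> B' j = B j.
    by rewrite /B'; case: eqP => // ->; rewrite (negbTE iJ).
  have := indep (i |: J) mB'; rewrite big_setU1//= {2}/B' eqxx.
  rewrite (eq_bigr (fun j => P (Z j @^-1` B j))); last by move=> j /eqB' ->.
  rewrite -(indep J mB) => <-; congr (P _); apply/seteqP; split => w /=.
    move=> [Bw Aw] j /=; rewrite !inE => /orP[/eqP->|jJ].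
      by rewrite /B' eqxx.
    by rewrite eqB'//; exact: Bw.
  move=> Bw; split => [j /= jJ|].
    by have := Bw j; rewrite /= !inE jJ orbT eqB'//; exact.
  by have := Bw i; rewrite /= !inE eqxx /B' eqxx; exact.
- move=> k; rewrite setTI; apply: le_lt_trans (probability_le1 P mZA) _.
  by rewrite ltry.
Qed.

(** The law of [w |-> (Z i w, w)] on [R * past J] is the product of its marginals by [indep_past];
    Tonelli then integrates [Z i] first. The identity as second component lets [F] depend on all
    variables in [J] at once. *)
Lemma decoupling (J : {set I}) i (F : R * past J -> \bar R) : i \notin J ->
  measurable_fun setT F -> (forall x, 0 <= F x) ->
  \int[P]_w F (Z i w, w) = \int[P]_w \int[P]_w' F (Z i w', w).
Proof.
move=> iJ mF F0.
pose idp : T -> past J := id.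
have mid : measurable_fun setT idp.
  exact: (@past_measurable J _ (past J) id).
pose phi (w : T) : R * past J := (Z i w, w).
have mphi : measurable_fun setT phi.
  exact: measurable_fun_pair.
pose phi_mixin := isMeasurableFun.Build _ _ _ _ _ mphi.
pose phi_rv : {mfun T >-> (R * past J)%type} := HB.pack phi phi_mixin.
pose id_mixin := isMeasurableFun.Build _ _ _ _ _ mid.
pose id_rv : {mfun T >-> past J} := HB.pack idp id_mixin.
pose m1 : probability R R := distribution P (Z i).
pose m2 : probability (past J) R := distribution P id_rv.
pose m : probability _ R := distribution P phi_rv.
transitivity (\int[m]_z F z).
  by rewrite ge0_integral_pushforward//; move=> z _; exact: F0.
transitivity (\int[m1 \x m2]_z F z).
  apply: eq_measure_integral => A mA _; apply/esym.
  apply: product_measure_unique => // B C mB mC.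
  exact: (indep_past iJ mB mC).
rewrite fubini_tonelli1// fubini_tonelli//.
rewrite ge0_integral_pushforward//; last 2 first.
- exact: measurable_fun_fubini_tonelli_G.
- by move=> z _; exact: integral_ge0.
apply: eq_integral => w _ /=; rewrite /fubini_G.
rewrite ge0_integral_pushforward//.
by apply: measurableT_comp => //; exact: measurable_fun_pair.
Qed.

End Decoupling.

(** * Integral estimates and exponential moments *)

Section RealEstimates.
Context (R : realType).

Lemma fact_double_le m : ((2 * m)`! <= (2 * m) ^ m * m`!)%N.
Proof.
have H j : (j <= m)%N -> ((m + j)`! <= (2 * m) ^ j * m`!)%N.
  elim: j => [|j IHj] jm; first by rewrite addn0 expn0 mul1n.
  rewrite addnS factS expnS -mulnA leq_mul//; last exact/IHj/ltnW.
  by lia.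
by have := H m (leqnn m); rewrite addnn -mul2n.
Qed.

Lemma expRN_normr (x : R) : (expR `|x| <= expR x + expR (- x))%R.
Proof.
have ex := expR_ge0 x; have eNx := expR_ge0 (- x).
by case: (lerP 0 x) => x0; rewrite ?(ger0_norm x0) ?(ltr0_norm x0) ?lerDl ?lerDr.
Qed.

(** The term of order [2m] in the series of [expR |s z|] is [(2m)^m z^(2m) / (2m)!], and
    [fact_double_le] bounds it below by [z^(2m) / m!]. *)
Lemma moment_le (lam z s : R) (m : nat) : 0 <= lam -> s ^+ 2 = (2 * m)%:R ->
  (lam * z ^+ 2) ^+ m / m`!%:R <=
   lam ^+ m * (expR (s * z) + expR (- s * z)).
Proof.
case: m => [|m] lam0 s2.
  have -> : s = 0 by apply/eqP; rewrite -sqrf_eq0 s2 muln0.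
  by rewrite !expr0 fact0 divr1 mul1r oppr0 mul0r expR0; lra.
rewrite exprMn -mulrA ler_wpM2l ?exprn_ge0//.
rewrite mulNr; apply: le_trans (expRN_normr _).
refine (le_trans _ (expR_ge1Dxn (2 * m).+1 (normr_ge0 (s * z)))).
have e2 : ((2 * m).+2 = 2 * m.+1)%N by lia.
have -> : `|s * z| ^+ (2 * m).+2 = (2 * m.+1)%:R ^+ m.+1 * z ^+ (2 * m.+1).
  by rewrite e2 exprM real_normK ?num_real// [(s * z) ^+ 2]exprMn s2 exprMn -exprM.
rewrite e2 -exprM.
have zz : (0 <= z ^+ (2 * m.+1))%R by rewrite exprn_even_ge0// mul2n odd_double.
suff : (z ^+ (2 * m.+1) / m.+1`!%:R <=
   (2 * m.+1)%:R ^+ m.+1 * z ^+ (2 * m.+1) / (2 * m.+1)`!%:R)%R by move=> ?; lra.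
rewrite [(_ ^+ m.+1 * _)%R]mulrC -mulrA ler_wpM2l//.
rewrite ler_pdivlMr ?ltr0n ?fact_gt0// mulrC ler_pdivrMr ?ltr0n ?fact_gt0//.
by rewrite -natrX -natrM ler_nat fact_double_le.
Qed.

(** Keeping the zeroth term at 1 makes the bound [1 + O(x)], so that a product of many such factors
    stays controlled. *)
Lemma geometric_half (x : R) (N : nat) : (0 <= x <= 1/2)%R ->
  (\sum_(0 <= m < N) (if m == 0%N then 1 else 2 * x ^+ m) <= 1 + 4 * x)%R.
Proof.
move=> /andP[x0 x1].
have S k : (\sum_(0 <= m < k) x ^+ m <= 2)%R.
  elim: k => [|k IHk]; first by rewrite big_nil.
  rewrite big_nat_recl// expr0.
  under eq_bigr do rewrite exprS.
  rewrite -mulr_sumr.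
  have : (0 <= \sum_(0 <= i < k) x ^+ i)%R by apply: sumr_ge0 => i _; exact: exprn_ge0.
  by move=> S0; nra.
case: N => [|N]; first by rewrite big_nil; lra.
rewrite big_nat_recl//=; under eq_bigr do rewrite exprS mulrCA.
by rewrite -!mulr_sumr; have SN := S N; nra.
Qed.

End RealEstimates.

Section Integrals.
Local Open Scope classical_set_scope.
Local Open Scope ereal_scope.
Context d (T : measurableType d) (R : realType).

(** The integral of a nonnegative function is a supremum over the simple functions below it, hence
    monotone. *)
Lemma le_integral_nonmeasurable (mu : {measure set T -> \bar R})
    (f g : T -> \bar R) :
  (forall x, 0 <= f x) -> (forall x, f x <= g x) ->
  \int[mu]_x f x <= \int[mu]_x g x.
Proof.
move=> f0 fg; have g0 x : 0 <= g x := le_trans (f0 x) (fg x).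
rewrite !ge0_integralTE//; apply: le_ereal_sup => _ [h hf <-].
by exists h => // x; exact: le_trans (hf x) (fg x).
Qed.

Variables (P : probability T R).

Lemma integral_probability_cst (a : R) : \int[P]__ a%:E = a%:E.
Proof. by rewrite integral_cst//= probability_setT mule1. Qed.

Lemma integral_affine_le (a b m : R) (W : T -> R) :
  (0 <= a)%R -> (0 <= b)%R -> (forall w, (0 <= W w)%R) -> measurable_fun setT W ->
  \int[P]_w (W w)%:E <= m%:E ->
  \int[P]_w (a + b * W w)%:E <= (a + b * m)%:E.
Proof.
move=> a0 b0 W0 mW Wm.
have mEW : measurable_fun setT (EFin \o W) by exact/measurable_EFinP.
under eq_integral do rewrite EFinD EFinM.
rewrite ge0_integralD//; last 2 first.
- by move=> w _; rewrite lee_fin mulr_ge0.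
- exact: measurable_funeM.
rewrite integral_probability_cst ge0_integralZl_EFin//; last first.
  by move=> w _; rewrite lee_fin.
by rewrite EFinD EFinM leeD2l// lee_wpmul2l.
Qed.

(** The exponential series is integrated termwise. At [s = sqrt (2m)] the subgaussian bound
    [expR (s^2 / 2)] equals [e^m], so [moment_le] bounds the [m]-th term by [2 (lam e)^m], and the
    series is geometric. *)
Lemma expR_square_mgf (Z : {RV P >-> R}) (lam : R) : subgaussian1 Z ->
  (0 <= lam)%R -> (lam * expR 1 <= 1/2)%R ->
  \int[P]_w (expR (lam * Z w ^+ 2))%:E <= (expR (4 * expR 1 * lam))%:E.
Proof.
move=> sZ lam0 lam1.
have mZ : measurable_fun setT Z by [].
pose f (m : nat) w := ((lam * Z w ^+ 2) ^+ m / m`!%:R)%:E.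
have f0 m w : 0 <= f m w.
  by rewrite lee_fin mulr_ge0// exprn_ge0// mulr_ge0// sqr_ge0.
have mf m : measurable_fun setT (f m).
  apply/measurable_EFinP; apply: measurable_funM => //.
  apply: measurable_funX; apply: measurable_funM => //.
  exact: measurable_funX.
have -> : \int[P]_w (expR (lam * Z w ^+ 2))%:E = \int[P]_w \sum_(m <oo) f m w.
  apply: eq_integral => w _; rewrite /expR -EFin_lim; last exact: is_cvg_series_exp_coeff.
  apply/congr_lim/funext => k /=; rewrite /series/= -sumEFin//.
rewrite integral_nneseries//.
apply: lime_le.
  by apply: is_cvg_nneseries => n _ _; apply: integral_ge0 => w _; exact: f0.
apply: nearW => N.
have x01 : (0 <= lam * expR 1 <= 1/2)%R by rewrite lam1 mulr_ge0// expR_ge0.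
apply: (@le_trans _ _ (1 + 4 * (lam * expR 1))%:E); last first.
  rewrite lee_fin; apply: le_trans (expR_ge1Dx _) _.
  by rewrite ler_expR; lra.
apply: le_trans (_ : _ <= (\sum_(0 <= m < N)
    (if m == 0%N then 1 else 2 * (lam * expR 1) ^+ m))%:E) _; last first.
  by rewrite lee_fin geometric_half.
rewrite -sumEFin; apply: lee_sum => m _; case: eqP => [->|_].
  under eq_integral do rewrite /f expr0 fact0 divr1.
  by rewrite integral_probability_cst.
pose s : R := Num.sqrt (2 * m)%:R.
have ss : (s ^+ 2 = (2 * m)%:R)%R by rewrite sqr_sqrtr.
have mgf (t : R) : (t ^+ 2 = (2 * m)%:R)%R ->
    \int[P]_w (expR (t * Z w))%:E <= (expR 1 ^+ m)%:E.
  move=> t2; under eq_integral do rewrite mulrC.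
  have := sZ t; rewrite /mmt_gen_fun unlock /= => /le_trans; apply.
  by rewrite lee_fin t2 -expRM_natl natrM mulrAC mulfV// mul1r mulr1.
apply: (@le_trans _ _ (\int[P]_w ((lam ^+ m)%:E *
    ((expR (s * Z w))%:E + (expR (- s * Z w))%:E)))).
  by apply: le_integral_nonmeasurable => // w; rewrite lee_fin moment_le.
have me t : measurable_fun setT (fun w => (expR (t * Z w))%:E).
  apply/measurable_EFinP; apply: measurableT_comp => //.
  exact: measurable_funM.
have pe t w : 0 <= (expR (t * Z w))%:E by rewrite lee_fin expR_ge0.
rewrite ge0_integralZl_EFin ?exprn_ge0//; last 2 first.
- by move=> w _; rewrite adde_ge0.
- exact: emeasurable_funD.
rewrite ge0_integralD//.
rewrite exprMn [(2 * _)%R]mulrCA EFinM lee_wpmul2l ?lee_fin ?exprn_ge0//.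
rewrite (_ : (2 * _)%R = (expR 1 ^+ m + expR 1 ^+ m)%R); last by lra.
by rewrite EFinD leeD// mgf// sqrrN.
Qed.

End Integrals.

Lemma measurable_sum_in d (T : measurableType d) (R : realType) (K : eqType)
    (s : seq K) (f : K -> T -> R) :
  {in s, forall k, measurable_fun setT (f k)} ->
  measurable_fun setT (fun w => \sum_(k <- s) f k w).
Proof.
elim: s => [|k s IHs] mf.
  by under eq_fun do rewrite big_nil; exact: measurable_cst.
under eq_fun do rewrite big_cons.
apply: measurable_funD; first by apply: mf; rewrite mem_head.
by apply: IHs => j js; apply: mf; rewrite inE js orbT.
Qed.

(** * Exponential moments of linear and bilinear forms in independent variables *)

Section MomentGeneratingFunctions.
Local Open Scope classical_set_scope.
Context d (T : measurableType d) (R : realType) (P : probability T R).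
Context (I : finType) (Z : I -> {RV P >-> R}).
Hypothesis indep : mutually_independent Z.
Hypothesis subgaussian : forall i, subgaussian1 (Z i).
Notation past := (past Z).

(** A conditional expectation bound: [U] and [V] depend only on the variables in [J], so they are
    frozen while [Z i] is integrated. *)
Lemma integrate_out (J : {set I}) i (g : R * R -> R) (h : R -> R)
    (U V : T -> R) : i \notin J ->
  measurable_fun setT g -> (forall x, 0 <= g x) ->
  (forall u, (\int[P]_w (g (Z i w, u))%:E <= (h u)%:E)%E) ->
  measurable_fun [set: past J] U -> measurable_fun [set: past J] V ->
  (forall w, 0 <= V w) ->
  (\int[P]_w (g (Z i w, U w) * V w)%:E <= \int[P]_w (h (U w) * V w)%:E)%E.
Proof.
move=> iJ mg g0 gh mU mV V0.
pose F (z : R * past J) : \bar R := (g (z.1, U z.2) * V z.2)%:E.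
have mF : measurable_fun setT F.
  apply/measurable_EFinP; apply: measurable_funM.
    apply: (measurableT_comp mg); apply: measurable_fun_pair => //.
    exact: (measurableT_comp mU).
  exact: (measurableT_comp mV).
have F0 z : (0 <= F z)%E by rewrite lee_fin mulr_ge0.
have mZ : measurable_fun setT (Z i) by [].
rewrite (decoupling indep iJ mF F0); apply: le_integral_nonmeasurable => w.
  by apply: integral_ge0 => w' _; exact: F0.
rewrite /F /=; under eq_integral do rewrite mulrC EFinM.
rewrite ge0_integralZl_EFin//; last 2 first.
- by move=> w' _; rewrite lee_fin.
- apply/measurable_EFinP; apply: (measurableT_comp mg).
  exact: measurable_fun_pair.
by rewrite mulrC EFinM lee_wpmul2l// lee_fin.
Qed.

Lemma past_subset (J J' : {set I}) : J \subset J' ->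
  forall d' (T' : measurableType d') (f : T -> T'),
  measurable_fun [set: past J] f -> measurable_fun [set: past J'] f.
Proof.
move=> JJ' d' T' f mf _ B mB; have := mf measurableT B mB.
apply: smallest_sub => /=; last first.
  move=> _ [C mC ->]; apply: sub_sigma_algebra.
  exists (fun i => if i \in J then C i else setT); first by move=> i; case: ifP.
  apply/seteqP; split => w Cw i /= iJ; last first.
    by have := Cw i (fintype.subsetP JJ' i iJ); rewrite /= iJ.
  by case: ifP => // iJ''; exact: Cw.
exact: smallest_sigma_algebra.
Qed.

Lemma linear_mgf (a : I -> R) (s : seq I) : uniq s ->
  (\int[P]_w (expR (\sum_(i <- s) a i * Z i w))%:E <=
   (expR (\sum_(i <- s) a i ^+ 2 / 2))%:E)%E.
Proof.
elim: s => [|i s IHs] /=.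
  by move=> _; under eq_integral do rewrite big_nil expR0;
    rewrite big_nil expR0 integral_probability_cst.
move=> /andP[si us]; rewrite big_cons expRD mulrC EFinM.
pose J : {set I} := [set j in s]%SET.
pose V w := expR (\sum_(j <- s) a j * Z j w).
have mV : measurable_fun [set: past J] V.
  apply: measurableT_comp => //; rewrite /=.
  apply: measurable_sum_in => j js; apply: measurable_funM => //.
  by apply: past_RV; rewrite inE.
have mg : measurable_fun setT (fun z : R * R => expR (a i * z.1)).
  apply: measurableT_comp => //; exact: measurable_funM.
have V0 w : 0 <= V w by exact: expR_ge0.
under eq_integral do rewrite big_cons expRD.
apply: (le_trans (@integrate_out J i (fun z => expR (a i * z.1))
  (fun=> expR (a i ^+ 2 / 2)) (fun=> 0) V _ mg _ _ _ mV V0)) => //=.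
- by rewrite inE.
- move=> _; under eq_integral do rewrite mulrC.
  by have := subgaussian i (a i); rewrite /mmt_gen_fun unlock.
under eq_integral do rewrite EFinM.
rewrite ge0_integralZl_EFin ?expR_ge0//; last 2 first.
- by move=> w _; rewrite lee_fin.
- apply/measurable_EFinP; exact: (past_measurable mV).
by rewrite muleC lee_wpmul2r ?lee_fin ?expR_ge0// IHs.
Qed.

(** One product is removed at a time. Integrating its first factor leaves [expR (t^2 / 2 * y^2)] in
    the second factor [y], which [expR_square_mgf] handles at [lam = t^2 / 2]; the condition on [t]
    is its condition on [lam]. *)
Lemma bilinear_mgf (K : eqType) (x y : K -> I) (t : R) (s : seq K) :
  (t ^+ 2 * expR 1 <= 1) ->
  uniq (map x s ++ map y s) ->
  (\int[P]_w (expR (t * \sum_(k <- s) Z (x k) w * Z (y k) w))%:E <=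
   (expR (2 * expR 1 * t ^+ 2 * (size s)%:R))%:E)%E.
Proof.
move=> te; elim: s => [|k s IHs] /=.
  by move=> _; under eq_integral do rewrite big_nil mulr0 expR0;
    rewrite mulr0 expR0 integral_probability_cst.
rewrite -[y k :: _]cat1s uniq_catCA cat1s /= mem_cat inE !negb_or.
move=> /andP[/and3P[xs xy xsy] /andP[ys us]].
pose J : {set I} := [set j in map x s ++ map y s]%SET.
pose J' : {set I} := (y k |: J)%SET.
have JJ' : J \subset J' by exact: subsetU1.
pose V w := expR (t * \sum_(j <- s) Z (x j) w * Z (y j) w).
have mV : measurable_fun [set: past J] V.
  apply: measurableT_comp => //=; apply: measurable_funM => //.
  apply: measurable_sum_in => j js; apply: measurable_funM => //;
    by apply: past_RV; rewrite inE mem_cat map_f ?orbT.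
have mV' : measurable_fun [set: past J'] V := past_subset JJ' mV.
have V0 w : 0 <= V w by exact: expR_ge0.
have mU : measurable_fun [set: past J'] (Z (y k)).
  by apply: past_RV; rewrite !inE eqxx.
have mg : measurable_fun setT (fun z : R * R => expR (t * z.2 * z.1)).
  apply: measurableT_comp => //; apply: measurable_funM => //.
  exact: measurable_funM.
under eq_integral do rewrite big_cons mulrDr expRD [Z (x k) _ * _]mulrC mulrA.
(* First [Z (x k)] is integrated, with [Z (y k)] and all later products frozen. *)
apply: (le_trans (@integrate_out J' (x k) (fun z => expR (t * z.2 * z.1))
  (fun u => expR (t ^+ 2 / 2 * u ^+ 2)) (Z (y k)) V _ mg _ _ mU mV' V0)) => //=.
- by rewrite !inE mem_cat !negb_or xy xs xsy.
- move=> u; under eq_integral do rewrite mulrC.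
  have := subgaussian (x k) (t * u); rewrite /mmt_gen_fun unlock /= exprMn.
  by rewrite mulrAC.
have mh : measurable_fun setT (fun z : R * R => expR (t ^+ 2 / 2 * z.1 ^+ 2)).
  apply: measurableT_comp => //; apply: measurable_funM => //.
  exact: measurable_funX.
(* Then [Z (y k)] is integrated, with only the later products frozen. *)
apply: (le_trans (@integrate_out J (y k) (fun z => expR (t ^+ 2 / 2 * z.1 ^+ 2))
  (fun=> expR (4 * expR 1 * (t ^+ 2 / 2))) (fun=> 0) V _ mh _ _ _ mV V0)) => //=.
- by rewrite inE.
- have t0 : 0 <= t ^+ 2 by exact: sqr_ge0.
  by move=> _; apply: expR_square_mgf => //; lra.
under eq_integral do rewrite EFinM.
rewrite ge0_integralZl_EFin ?expR_ge0//; last 2 first.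
- by move=> w _; rewrite lee_fin.
- apply/measurable_EFinP; exact: (past_measurable mV).
rewrite -[(size s).+1%:R]natr1 mulrDr mulr1 expRD muleC EFinM.
rewrite (_ : 4 * expR 1 * (t ^+ 2 / 2) = 2 * expR 1 * t ^+ 2); last by lra.
by rewrite lee_wpmul2r ?lee_fin ?expR_ge0// IHs.
Qed.

End MomentGeneratingFunctions.

(** * Rows of a Toeplitz matrix with a nonincreasing profile *)

Section ToeplitzRows.
Context (R : realType) (n : nat).
Implicit Types (f g : nat -> R) (u v i j k l : nat).

Definition gap u v : nat := absz (u%:Z - v%:Z).

Definition row_sum g u : R := \sum_(l < n) g (gap u l).

Definition row_dist2 f u v : R := \sum_(l < n) (f (gap u l) - f (gap v l)) ^+ 2.

Lemma gap_sym u v : gap u v = gap v u.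
Proof. by rewrite /gap; lia. Qed.

Lemma row_sum_rev g u : (u < n)%N -> row_sum g (n.-1 - u) = row_sum g u.
Proof.
move=> un; rewrite /row_sum (reindex_inj rev_ord_inj) /=.
by apply: eq_bigr => l _; congr (g _); have := ltn_ord l; rewrite /gap; lia.
Qed.

Lemma row_dist2_rev f u v : (u < n)%N -> (v < n)%N ->
  row_dist2 f (n.-1 - u) (n.-1 - v) = row_dist2 f u v.
Proof.
move=> un vn; rewrite /row_dist2 (reindex_inj rev_ord_inj) /=.
apply: eq_bigr => l _; have ln := ltn_ord l.
by congr ((f _ - f _) ^+ 2); rewrite /gap; lia.
Qed.

Lemma row_dist2_sym f u v : row_dist2 f u v = row_dist2 f v u.
Proof. by apply: eq_bigr => l _; rewrite -sqrrN opprB. Qed.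

(** Row [u.+1] is row [u] shifted by one place: the difference telescopes to the entry that enters
    minus the entry that leaves. *)
Lemma row_sum_step g u : (u.+1 < n)%N ->
  row_sum g u.+1 - row_sum g u = g u.+1 - g (n.-1 - u)%N.
Proof.
move=> un; rewrite /row_sum -sumrB.
transitivity (\sum_(0 <= l < n) (g (gap u.+1 l) - g (gap u.+1 l.+1))).
  rewrite big_mkord; apply: eq_bigr => l _.
  by congr (_ - g _); rewrite /gap; lia.
rewrite (@telescope_sumr_eq _ 0 n (fun l => - g (gap u.+1 l)))//; last first.
  by move=> l _; rewrite opprK addrC.
by rewrite opprK addrC; congr (g _ - g _); rewrite /gap; lia.
Qed.

Variables (f : nat -> R) (A : R).
Hypothesis f_anti : forall i j, (i <= j)%N -> f j <= f i.
Hypothesis f_ge0 : forall i, 0 <= f i.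
Hypothesis f_le : forall i, f i <= A.

(** The two rows are shifts of one unimodal sequence [b] with values in [[0, A]]. Each squared
    increment is at most [A] times its absolute value, and the total variation of [b] is at most
    [2 A]. *)
Lemma row_dist2_step u : (u.+1 < n)%N -> row_dist2 f u u.+1 <= 2 * A ^+ 2.
Proof.
move=> un; pose b l := f (gap u.+1 l).
have bE l : f (gap u l) = b l.+1 by congr f; rewrite /gap; lia.
have A0 : 0 <= A by exact: le_trans (f_ge0 0) (f_le 0).
have bA l : 0 <= b l <= A by rewrite /b f_ge0 f_le.
apply: (@le_trans _ _ (\sum_(0 <= l < n) A * `|b l.+1 - b l|)).
  rewrite big_mkord; apply: ler_sum => l _; rewrite bE -/(b l) -real_normK ?num_real//.
  rewrite expr2 ler_wpM2r// ler_norml; have := bA l; have := bA l.+1.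
  by move=> /andP[? ?] /andP[? ?]; apply/andP; split; lra.
rewrite -mulr_sumr expr2 mulrCA ler_wpM2l//.
(* The sequence [b] rises up to its peak at [u.+1] and falls after it. *)
rewrite (@big_cat_nat _ _ _ u.+1)//=; last by lia.
rewrite (@eq_big_nat _ _ _ 0 u.+1 _ (fun l => b l.+1 - b l)); last first.
  move=> l /andP[_ lu]; rewrite ger0_norm// subr_ge0; apply: f_anti.
  by rewrite /gap; lia.
rewrite (@eq_big_nat _ _ _ u.+1 n _ (fun l => b l - b l.+1)); last first.
  move=> l /andP[ul _]; rewrite distrC ger0_norm// subr_ge0; apply: f_anti.
  by rewrite /gap; lia.
rewrite telescope_sumr//.
rewrite (@eq_bigr _ _ _ _ _ _ _ (fun l => - (b l.+1 - b l))); last first.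
  by move=> *; rewrite opprB.
rewrite sumrN telescope_sumr//; last by lia.
have /andP[? ?] := bA u.+1; have /andP[? ?] := bA 0; have /andP[? ?] := bA n.
by lra.
Qed.

(* Where [2 l <= i + j] or [j + k <= 2 l], the term at [l] on the left is at
   most the term at [l] on the right. The remaining [l] are moved by [k - j]
   or by [i - j], injectively, to points with the same property; hence the
   factor 2. *)
Lemma row_dist2_monol i j k : (i < j)%N -> (j < k)%N -> (k < n)%N ->
  row_dist2 f i j <= 2 * row_dist2 f i k.
Proof.
move=> ij jk kn.
pose mid (l : 'I_n) := (i + j < 2 * l)%N && (2 * l < j + k)%N.
pose F (l : nat) := (f (gap i l) - f (gap j l)) ^+ 2.
pose G (l : nat) := (f (gap i l) - f (gap k l)) ^+ 2.
have sqle a b c e : (a <= b)%N -> (c <= e)%N -> (a <= c)%N -> (b <= e)%N -> (b <= c)%N ->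
    (f b - f c) ^+ 2 <= (f a - f e) ^+ 2.
  move=> ab ce ac be bc; have := f_anti ab; have := f_anti ce; have := f_anti bc.
  by move=> *; rewrite ler_sqr ?nnegrE; lra.
have sqleC a b c e : (a <= b)%N -> (c <= e)%N -> (a <= c)%N -> (b <= e)%N -> (b <= c)%N ->
    (f c - f b) ^+ 2 <= (f e - f a) ^+ 2.
  by move=> *; rewrite -[X in X <= _]sqrrN -[X in _ <= X]sqrrN !opprB sqle.
have sqleX a b c e : (a <= b)%N -> (c <= e)%N -> (a <= c)%N -> (b <= e)%N -> (b <= c)%N ->
    (f c - f b) ^+ 2 <= (f a - f e) ^+ 2.
  by move=> *; rewrite -[X in X <= _]sqrrN opprB sqle.
have Fid (l : 'I_n) : ~~ mid l -> F l <= G l.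
  rewrite /mid negb_and -!leqNgt => /orP[lij|ljk].
    by apply: sqle; rewrite /gap; lia.
  by apply: sqleC; rewrite /gap; lia.
pose sh (l : 'I_n) : 'I_n := insubd l (if (l <= j)%N then l + (k - j) else l - (j - i))%N.
have shE (l : 'I_n) : mid l -> sh l = (if (l <= j)%N then l + (k - j) else l - (j - i))%N :> nat.
  move=> /andP[m1 m2]; rewrite val_insubd; case: ifP => // /negbT.
  by have := ltn_ord l; case: ifP; lia.
(* Points moved right land beyond [k - (j - i) / 2], points moved left land before
   [i + (k - j) / 2], so the two images are disjoint. *)
have sh_inj : {in mid &, injective sh}.
  move=> l l'; rewrite !unfold_in => ml ml' /(congr1 val) /=; rewrite !shE// => e.
  apply/val_inj => /=; move: ml ml' e => /andP[? ?] /andP[? ?].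
  by do 2 case: ifP; lia.
have Fsh (l : 'I_n) : mid l -> F l <= G (sh l).
  move=> ml; rewrite shE//; move: ml => /andP[? ?]; case: ifP => lj.
    by apply: sqleC; rewrite /gap; lia.
  by apply: sqleX; rewrite /gap; lia.
have G0 l : 0 <= G l by exact: sqr_ge0.
rewrite /row_dist2 -/F (bigID mid) /= mulr_natl mulr2n lerD//.
  apply: le_trans (ler_sum _ Fsh) _.
  rewrite -(big_imset (fun l : 'I_n => G l) sh_inj) /=.
  rewrite [leRHS](bigID (mem (sh @: mid))) /= lerDl.
  by apply: sumr_ge0 => l _; exact: sqr_ge0.
rewrite [leRHS](bigID mid) /= ler_wpDl//.
  by apply: sumr_ge0 => l _; exact: sqr_ge0.
by apply: ler_sum => l /Fid.
Qed.

Lemma row_dist2_monor i j k : (i < j)%N -> (j < k)%N -> (k < n)%N ->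
  row_dist2 f j k <= 2 * row_dist2 f i k.
Proof.
move=> ij jk kn.
have jn := ltn_trans jk kn; have i_n := ltn_trans ij jn.
rewrite -(row_dist2_rev f jn kn) -(row_dist2_rev f i_n kn).
rewrite ![row_dist2 f _ (n.-1 - k)]row_dist2_sym.
by apply: row_dist2_monol; lia.
Qed.

Lemma row_sum_step_le u : (u.+1 < n)%N -> `|row_sum f u.+1 - row_sum f u| <= A.
Proof.
move=> un; rewrite row_sum_step// ler_norml.
have := f_ge0 u.+1; have := f_le u.+1; have := f_ge0 (n.-1 - u); have := f_le (n.-1 - u).
by move=> *; apply/andP; split; lra.
Qed.

Let f2 l := f l ^+ 2.

Lemma row_sum_sqr_step_le u : (u.+1 < n)%N ->
  `|row_sum f2 u.+1 - row_sum f2 u| <= A ^+ 2.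
Proof.
move=> un; rewrite row_sum_step// ler_norml /f2.
have := f_ge0 u.+1; have := f_le u.+1; have := f_ge0 (n.-1 - u); have := f_le (n.-1 - u).
by move=> *; apply/andP; split; nra.
Qed.

(* Up to the middle row, [2 * A * S - G] is nondecreasing, where [S] and [G]
   are the row sums of [f] and [f ^+ 2]. *)
Lemma row_sum_sqr_le u v : (u < n)%N -> (v < n)%N ->
  row_sum f2 v - row_sum f2 u <= 2 * A * `|row_sum f v - row_sum f u|.
Proof.
have incr i j : (i <= j)%N -> (2 * j < n.+1)%N ->
    0 <= row_sum f2 j - row_sum f2 i <= 2 * A * (row_sum f j - row_sum f i).
  elim: j => [|j IHj]; first by rewrite leqn0 => /eqP->; rewrite !subrr mulr0 lexx.
  rewrite leq_eqVlt => /orP[/eqP->|]; first by rewrite !subrr mulr0 lexx.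
  rewrite ltnS => ij jn; have {IHj} := IHj ij ltac:(lia).
  have jn' : (j.+1 < n)%N by lia.
  have := row_sum_step f jn'; have := row_sum_step f2 jn'; rewrite /f2.
  have h : (j.+1 <= n.-1 - j)%N by lia.
  have := f_anti h; have := f_ge0 j.+1; have := f_le j.+1; have := f_ge0 (n.-1 - j).
  set a := f j.+1; set b := f (n.-1 - j) => b0 aA a0 ba e2 e1 /andP[H1 H2].
  have A0 : 0 <= A by lra.
  have E2 : row_sum (fun l => f l ^+ 2) j.+1 =
      row_sum (fun l => f l ^+ 2) j + (a ^+ 2 - b ^+ 2) by lra.
  have E1 : row_sum f j.+1 = row_sum f j + (a - b) by lra.
  rewrite E2 E1; apply/andP; split; first by nra.
  rewrite (_ : _ * (_ + _ - _) =
    2 * A * (row_sum f j - row_sum f i) + 2 * A * (a - b)); last by ring.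
  have : a ^+ 2 - b ^+ 2 <= 2 * A * (a - b) by nra.
  by lra.
move=> un vn.
(* Rows past the middle are reflected into the first half, with the same row sums. *)
have fold w : (w < n)%N ->
    exists2 w', (2 * w' < n.+1)%N & forall g, row_sum g w = row_sum g w'.
  move=> wn; have [w2|w2] := ltnP (2 * w) n; first by exists w => //; lia.
  by exists (n.-1 - w)%N => [|g]; [lia|rewrite row_sum_rev].
have [u' u2 uE] := fold u un; have [v' v2 vE] := fold v vn.
rewrite !uE !vE.
have A0 : 0 <= A := le_trans (f_ge0 0) (f_le 0).
have [uv|vu] := leqP u' v'.
  have /andP[_ /le_trans] := incr _ _ uv v2; apply.
  by rewrite ler_wpM2l ?mulr_ge0// ler_norm.
(* Here [v'] is farther from the middle, so the left-hand side is nonpositive. *)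
have /andP[+ _] := incr _ _ (ltnW vu) u2; rewrite -opprB oppr_ge0 => /le_trans; apply.
by rewrite !mulr_ge0.
Qed.
End ToeplitzRows.

(** * Deterministic analysis of PINES *)

Section Arrangements.
Context (n : nat).
Implicit Types (i j k u v w : 'I_n) (pos : 'I_n -> 'I_n).

Lemma pos_surj pos : injective pos -> forall x : 'I_n, exists u, pos u = x.
Proof. by move=> /injF_bij[g _ gK] x; exists (g x). Qed.

(** Pigeonhole: otherwise every object at position [p u] or later would have rank at least [p u],
    indeed larger, since [u] itself lies earlier. That is one object more than there are such
    ranks. *)
Lemma exists_inversion (pos p : 'I_n -> 'I_n) u : injective pos -> injective p ->
  (pos u < p u)%N -> exists2 w, (p u <= pos w)%N & (p w < p u)%N.
Proof.
move=> ipos ip pu.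
have /existsP[w /andP[]] : [exists w, (p u <= pos w)%N && (p w < p u)%N];
  last by exists w.
apply: contraT; rewrite negb_exists => /forallP H.
have sub : pos @^-1: [set x : 'I_n | (p u <= x)%N]
    \subset p @^-1: [set x : 'I_n | (p u < x)%N].
  apply/fintype.subsetP => w; rewrite !inE => uw; have := H w; rewrite uw /= -leqNgt.
  rewrite leq_eqVlt => /orP[/eqP/val_inj/ip e|//].
  by rewrite -e leqNgt pu in uw.
have := subset_leq_card sub; rewrite !card_preimset// leqNgt => /negP[].
apply: proper_card; apply/fintype.properP; split.
  by apply/fintype.subsetP => x; rewrite !inE => /ltnW.
by exists (p u); rewrite !inE ?leqnn ?ltnn.
Qed.

Section Chains.
Variable S : {set 'I_n}.

Definition before pos i : {set 'I_n} := [set j in S | (pos j < pos i)%N].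

Definition after pos i : {set 'I_n} := [set j in S | (pos i < pos j)%N].

Lemma after_rev pos i : before (@rev_ord n \o pos) i = after pos i.
Proof.
apply/setP => j; rewrite !inE /=; congr (_ && _).
by have := ltn_ord (pos i); have := ltn_ord (pos j); lia.
Qed.

Lemma before_rev pos i : after (@rev_ord n \o pos) i = before pos i.
Proof.
apply/setP => j; rewrite !inE /=; congr (_ && _).
by have := ltn_ord (pos i); have := ltn_ord (pos j); lia.
Qed.

(** A disjunction, because the labels minus and plus carry no orientation. *)
Definition splits pos i (Cm Cp : {set 'I_n}) : Prop :=
  (Cm = before pos i /\ Cp = after pos i) \/
  (Cm = after pos i /\ Cp = before pos i).

Lemma splits_rev pos i Cm Cp :
  splits pos i Cm Cp -> splits (@rev_ord n \o pos) i Cm Cp.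
Proof. by rewrite /splits after_rev before_rev; tauto. Qed.

Variables (Cm Cp : 'I_n -> {set 'I_n}).

(** The invariant of the recursive choice: [s] enumerates an initial segment of [S] along [pos]. *)
Definition sorted_prefix pos (s : seq 'I_n) : Prop :=
  [/\ {subset s <= S}, pairwise (fun i j => pos i < pos j)%N s
    & forall i j, i \in s -> j \in S -> (pos j < pos i)%N -> j \in s].

(** If [s] is what precedes [i], the prefix extends. It cannot be what follows [i]: being closed
    downwards, [s] would then contain [i]. *)
Lemma sorted_prefix_rcons pos s i : injective pos -> i \in S ->
  splits pos i (Cm i) (Cp i) -> s != [::] ->
  sorted_prefix pos s -> eligible S Cm Cp s i -> sorted_prefix pos (rcons s i).
Proof.
move=> inj iS spl s0 [sS s_lt s_closed] /andP[_].
have -> : (if s is [::] then Cp i == finset.set0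
    else (Cm i == [set j in s]) || (Cp i == [set j in s])) =
    (Cm i == [set j in s]) || (Cp i == [set j in s]) by case: s s0 {sS s_lt s_closed}.
move=> el; have {el} [/setP bs|/setP as_] :
    before pos i = [set j in s] \/ after pos i = [set j in s].
- by case: spl => -[e1 e2]; move: el; rewrite e1 e2 => /orP[] /eqP; tauto.
- split.
  + by move=> j; rewrite mem_rcons inE => /orP[/eqP->|/sS].
  + rewrite pairwise_rcons s_lt andbT; apply/allP => j js.
    by have := bs j; rewrite !inE js => /andP[].
  + move=> k j; rewrite !mem_rcons !inE => /orP[/eqP->|ks] jS jk.
      by have := bs j; rewrite !inE jS jk => <-; rewrite orbT.
    by rewrite (s_closed k j ks jS jk) orbT.
- case: s s0 sS s_lt s_closed as_ => // x s _ sS _ s_closed as_.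
  have := as_ x; rewrite !inE eqxx => /andP[xS ix].
  have := as_ i; rewrite !inE ltnn andbF -in_cons.
  by rewrite (s_closed x i (mem_head _ _) iS ix).
Qed.

(** The first element has an empty side, so it is an endpoint of [S]; which endpoint it is decides
    the orientation of the whole chain. *)
Lemma chain_sorted pos s : injective pos ->
  {in S, forall i, splits pos i (Cm i) (Cp i)} -> chain S Cm Cp s ->
  [\/ s = [::], sorted_prefix pos s | sorted_prefix (@rev_ord n \o pos) s].
Proof.
move=> inj spl; elim=> [|{}s i _ IHs el]; first by constructor.
have iS : i \in S by case/andP: el.
have [s0|s0] := eqVneq s [::]; last first.
  case: IHs => [/eqP|/sorted_prefix_rcons pre|/sorted_prefix_rcons pre].
  - by rewrite (negbTE s0).
  - by apply: Or32; apply: pre => //; exact: spl.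
  - apply: Or33; apply: pre => //; last exact/splits_rev/spl.
    exact: inj_comp rev_ord_inj inj.
move: el; rewrite s0 /= => /andP[_ /eqP Cp0].
have min pos' : before pos' i = finset.set0 -> sorted_prefix pos' [:: i].
  move=> b0; split => [j|//|k j]; rewrite !inE; first by move/eqP->.
  move=> /eqP -> jS ji; have : j \in before pos' i by rewrite inE jS.
  by rewrite b0 inE.
case: (spl i iS) => -[_ e2]; rewrite Cp0 in e2.
- by apply: Or33; apply: min; rewrite after_rev.
- by apply: Or32; apply: min.
Qed.

(** The earliest element of [S] outside [s] along [pos] is always eligible. *)
Lemma next_in_chain pos s : injective pos ->
  {in S, forall i, splits pos i (Cm i) (Cp i)} ->
  s != [::] -> sorted_prefix pos s -> (size s < #|S|)%N ->
  exists i, eligible S Cm Cp s i.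
Proof.
move=> inj spl s0 [sS s_lt s_closed] sizeS.
have us : uniq s.
  by apply: (pairwise_uniq _ s_lt) => x; rewrite ltnn.
have [j jS js] : exists2 j, j \in S & j \notin s.
  apply/exists_inP; rewrite -negb_forall_in; apply/negP => /forall_inP Ss.
  move: sizeS; rewrite ltnNge -(card_uniqP us) => /negP; apply.
  by apply: subset_leq_card; apply/fintype.subsetP.
have jSs : j \in S :\: [set k in s] by rewrite !inE js.
case: (@arg_minnP _ j (mem (S :\: [set k in s])) (fun x => pos x) jSs) => m.
rewrite /= !inE => /andP[ms mS] m_min; exists m; rewrite /eligible mS /=.
have bE : before pos m = [set j in s].
  apply/setP => k; rewrite !inE; apply/andP/idP => [[kS km]|ks].
    apply: contraLR km => ks; rewrite -leqNgt; apply: m_min.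
    by rewrite /= !inE ks.
  split; first exact: sS.
  rewrite ltnNge leq_eqVlt; apply/negP => /orP[/eqP/val_inj/inj mk|mk].
    by rewrite mk ks in ms.
  by rewrite (s_closed k m ks mS mk) in ms.
case: s s0 {sS s_lt s_closed sizeS us js ms jSs m_min} bE => // x s _ <-.
by case: (spl m mS) => -[-> ->]; rewrite eqxx ?orbT.
Qed.

End Chains.
End Arrangements.

(** * Components, traces and output of PINES for an approximate distance *)

Section PinesCorrectness.
Context (R : realType) (n : nat) (D : 'I_n -> 'I_n -> R) (alpha delta : R).
Implicit Types (i j k u v w : 'I_n) (pos : 'I_n -> 'I_n) (S : {set 'I_n}).

Definition linear_arrangement pos : Prop :=
  [/\ injective pos,
      forall i j k, (pos i < pos j)%N -> (pos j < pos k)%N ->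
        D i j <= alpha * D i k /\ D j k <= alpha * D i k
    & forall i j, pos j = (pos i).+1 :> nat -> D i j <= delta].

Hypothesis Dsym : forall i j, D i j = D j i.

Lemma linear_arrangement_rev pos :
  linear_arrangement pos -> linear_arrangement (@rev_ord n \o pos).
Proof.
case=> inj mono step; split.
- exact: inj_comp rev_ord_inj inj.
- move=> i j k /= ij jk; rewrite (Dsym i j) (Dsym j k) (Dsym i k).
  have [] // := mono k j i.
  + by have := ltn_ord (pos i); have := ltn_ord (pos j); have := ltn_ord (pos k); lia.
  + by have := ltn_ord (pos i); have := ltn_ord (pos j); have := ltn_ord (pos k); lia.
- move=> i j /= e; rewrite Dsym; apply: step.
  by have := ltn_ord (pos i); have := ltn_ord (pos j); lia.
Qed.

Hypothesis Dtri : forall i j k, D i k <= D i j + D j k.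
Variables (d : 'M[R]_n) (eps : R).
Hypothesis dsym : forall i j, d i j = d j i.
Hypothesis d0 : forall i, d i i = 0.
Hypothesis dD : forall i j, `|d i j - D i j| <= eps.
Hypothesis alpha_ge1 : 1 <= alpha.
Hypothesis delta_ge0 : 0 <= delta.
Hypothesis eps_ge0 : 0 <= eps.

Let rho3 := delta + eps.
Let rho2 := alpha * delta + 2 * (1 + alpha) * eps.
Let rho1 := alpha ^+ 2 * delta + (2 * alpha ^+ 2 + 3 * alpha + 2) * eps.

Lemma dD_le i j : d i j <= D i j + eps /\ D i j <= d i j + eps.
Proof. by have := dD i j; rewrite ler_norml => /andP[? ?]; split; lra. Qed.

Notation edge := (edge d rho2 rho3).
Notation far := (far d rho2).

Lemma far_neq i j : j \in far i -> j != i.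
Proof.
apply: contraTneq => ->; rewrite inE d0 -leNgt /rho2.
by have := alpha_ge1; have := delta_ge0; have := eps_ge0; nra.
Qed.

(** An edge across [i] would give [D i j <= alpha * (rho3 + eps)], hence [d i j <= rho2], although
    its endpoints are far from [i]. This dictates [rho2]. *)
Lemma edge_not_across pos i j k : linear_arrangement pos ->
  edge i j k -> (pos j < pos i)%N -> ~~ (pos i < pos k)%N.
Proof.
case=> _ mono _ /and4P[fj _ _ djk] ji; apply/negP => ik.
have [Dji _] := mono _ _ _ ji ik.
have [dij _] := dD_le i j; have [_ Djk] := dD_le j k.
move: fj; rewrite inE Dsym in dij * => fj.
have : D j i <= alpha * (rho3 + eps).
  by apply: le_trans Dji _; rewrite ler_wpM2l//; have := alpha_ge1; lra.
move: fj; rewrite /rho2 /rho3.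
by have := alpha_ge1; have := delta_ge0; have := eps_ge0; nra.
Qed.

Lemma edge_sym i : symmetric (edge i).
Proof.
move=> j k; rewrite /Defs.edge dsym eq_sym.
by case: (j \in _); case: (k \in _); rewrite ?andbF.
Qed.

Lemma connect_side pos i j k : linear_arrangement pos ->
  connect (edge i) j k -> (pos j < pos i)%N = (pos k < pos i)%N.
Proof.
move=> lin jk; have [inj _ _] := lin.
apply: (@closed_connect _ (edge i) [pred j | (pos j < pos i)%N]) jk => {j k} j k e.
have side x y : edge i x y -> (pos x < pos i)%N -> (pos y < pos i)%N.
  move=> exy xi; have := edge_not_across lin exy xi.
  rewrite -leqNgt leq_eqVlt => /orP[/eqP/val_inj/inj yi|//].
  by case/and4P: exy => _ /far_neq; rewrite yi eqxx.
by apply/idP/idP; [exact: side|rewrite edge_sym in e; exact: side].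
Qed.

(** Were [d i k <= rho2], then [D i j <= alpha * D i k] would give [d i j <= alpha * (rho2 + eps) +
    eps <= rho1]. This dictates [rho1]. *)
Lemma far_beyond pos i j k : linear_arrangement pos ->
  rho1 < d i j -> (pos i < pos j)%N -> (pos j <= pos k)%N -> k \in far i.
Proof.
case=> inj mono _ dij ij jk.
have Dik : D i j <= alpha * D i k.
  move: jk; rewrite leq_eqVlt => /orP[/eqP/val_inj/inj <-|jk].
    have : 0 <= D i j by have := Dtri i i j; have := Dtri i j i; rewrite (Dsym j i); lra.
    by have := alpha_ge1; nra.
  by have [] := mono _ _ _ ij jk.
rewrite inE ltNge; apply/negP => dik; move: dij; apply/negP; rewrite -leNgt.
have [le1 _] := dD_le i j; have [_ le2] := dD_le i k.
have : alpha * D i k <= alpha * (rho2 + eps).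
  by rewrite ler_wpM2l//; have := alpha_ge1; lra.
rewrite /rho1 /rho2 in dik *.
by have := alpha_ge1; have := delta_ge0; have := eps_ge0; nra.
Qed.

(** The latent order itself is a path: all objects from [j] to [k] are far from [i], and consecutive
    ones are within [delta + eps = rho3] in [d]. *)
Lemma connect_beyond pos i j k : linear_arrangement pos ->
  rho1 < d i j -> (pos i < pos j)%N -> (pos j <= pos k)%N ->
  connect (edge i) j k.
Proof.
move=> lin dij ij; have [inj _ step] := lin.
move: {2}(pos k - pos j)%N (erefl (pos k - pos j)%N) => m.
elim: m k => [|m IHm] k mE jk.
  have /inj -> : pos k = pos j by apply: val_inj; move: mE jk => /=; lia.
  exact: connect0.
have kn : ((pos k).-1 < n)%N by have := ltn_ord (pos k); lia.
have [k' k'E] := pos_surj inj (Ordinal kn).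
have k'v : pos k' = (pos k).-1 :> nat by rewrite k'E.
have jk' : (pos j <= pos k')%N by lia.
apply: connect_trans (IHm k' _ jk') (connect1 _); first by lia.
have kk' : k' != k by apply/eqP => e; move: k'v; rewrite e; lia.
rewrite /Defs.edge (far_beyond lin dij ij jk') (far_beyond lin dij ij jk) kk' /=.
have [le1 _] := dD_le k' k; have := step k' k; rewrite /rho3.
by move=> /(_ ltac:(lia)); lra.
Qed.

Section Traces.
Variables (S : {set 'I_n}) (packing : is_packing d rho1 S).
Notation before := (before S).
Notation after := (after S).
Notation splits := (splits S).

Lemma packing_far i j : i \in S -> j \in S -> i != j -> rho1 < d i j.
Proof.
move=> iS jS ij.
by have /forall_inP/(_ _ iS)/forall_inP/(_ _ jS)/implyP/(_ ij) := packing.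
Qed.

Lemma component_of i j : j \in far i ->
  [set y in far i | connect (edge i) j y] \in components d rho2 rho3 i.
Proof. by move=> jf; apply: imset_f. Qed.

Lemma after_component pos i : linear_arrangement pos -> i \in S ->
  after pos i != finset.set0 -> exists2 K, K \in components d rho2 rho3 i &
    after pos i \subset K.
Proof.
move=> lin iS /set0Pn[j ja].
(* The packing point nearest to [i] in position is connected to all those beyond it. *)
case: (@arg_minnP _ j (mem (after pos i)) (fun x => pos x) ja) => m ma m_min.
have [mS im] : m \in S /\ (pos i < pos m)%N.
  by move: ma; rewrite /= inE => /andP.
have dim : rho1 < d i m.
  by apply: packing_far => //; apply: contraTneq im => ->; rewrite ltnn.
exists [set y in far i | connect (edge i) m y].
  exact/component_of/(far_beyond lin dim im).
apply/fintype.subsetP => k /m_min mk.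
by rewrite inE (far_beyond lin dim im)// (connect_beyond lin dim im).
Qed.

Lemma before_component pos i : linear_arrangement pos -> i \in S ->
  before pos i != finset.set0 -> exists2 K, K \in components d rho2 rho3 i &
    before pos i \subset K.
Proof.
move=> /linear_arrangement_rev lin iS.
by rewrite -(before_rev S pos i); exact: after_component.
Qed.

Lemma component_side pos i K j k : linear_arrangement pos ->
  K \in components d rho2 rho3 i -> j \in K -> k \in K ->
  (pos j < pos i)%N -> ~~ (pos i < pos k)%N.
Proof.
move=> lin /imsetP[x xf ->]; rewrite !inE => /andP[_ xj] /andP[_ xk].
by rewrite -(connect_side lin xj) (connect_side lin xk) -leqNgt => /ltnW.
Qed.

Lemma before_afterE pos i : injective pos -> S :\ i = before pos i :|: after pos i.
Proof.
move=> inj; apply/setP => j; rewrite !inE andbC -andb_orr; congr (_ && _).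
by rewrite -neq_ltn -(inj_eq inj).
Qed.

(** Each side lies in one component and no component meets both sides, so a single one suffices
    exactly when a side is empty. *)
Lemma single_component pos i : linear_arrangement pos -> i \in S ->
  (S :\ i == finset.set0) || [exists K in components d rho2 rho3 i, S :\ i \subset K] =
  (before pos i == finset.set0) || (after pos i == finset.set0).
Proof.
move=> lin iS; have [inj _ _] := lin; rewrite (before_afterE i inj).
apply/idP/idP.
  rewrite finset.setU_eq0 => /orP[/andP[-> _//]|/exists_inP[K Kc]].
  rewrite finset.subUset => /andP[bK aK]; apply: contraT; rewrite negb_or.
  move=> /andP[/set0Pn[j jb] /set0Pn[k ka]].
  have := component_side lin Kc (fintype.subsetP bK j jb) (fintype.subsetP aK k ka).
  by move: jb ka; rewrite !inE => /andP[_ ->] /andP[_ ->] /(_ isT).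
have [->|b0] := eqVneq (before pos i) finset.set0.
  rewrite finset.set0U; have [->//|a0 _] := eqVneq (after pos i) finset.set0.
  have [K Kc aK] := after_component lin iS a0.
  by apply/orP; right; apply/exists_inP; exists K.
move=> /eqP ->; rewrite finset.setU0.
have [K Kc bK] := before_component lin iS b0.
by apply/orP; right; apply/exists_inP; exists K.
Qed.

(** With both sides nonempty, the two components must lie on different sides and together cover
    [S :\ i]. The second conjunct makes the endpoints of [S] valid first choices. *)
Lemma traces_split pos i Cm Cp : linear_arrangement pos -> i \in S ->
  is_traces d rho2 rho3 S i Cm Cp ->
  splits pos i Cm Cp /\
  ((before pos i == finset.set0) || (after pos i == finset.set0) ->
   Cp = finset.set0).
Proof.
move=> lin iS; have [inj _ _] := lin; rewrite /is_traces (single_component lin iS).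
have Q := before_afterE i inj.
case: ifP => [/orP[]/eqP e0 [-> ->]|/negbT].
- by split=> //; right; rewrite Q e0 finset.set0U.
- by split=> //; left; rewrite Q e0 finset.setU0.
rewrite negb_or => /andP[b0 a0] [Km [Kp [Kmc Kpc QK -> ->]]].
split; last by [].
have sideQ K j : K \in components d rho2 rho3 i -> j \in K -> (pos j < pos i)%N ->
    K :&: (S :\ i) \subset before pos i.
  move=> Kc jK ji; rewrite Q; apply/fintype.subsetP => k.
  rewrite finset.in_setI finset.in_setU.
  move=> /andP[kK /orP[//|ka]]; have := component_side lin Kc jK kK ji.
  by move: ka; rewrite inE => /andP[_ ->].
have sideQ' K j : K \in components d rho2 rho3 i -> j \in K -> (pos i < pos j)%N ->
    K :&: (S :\ i) \subset after pos i.
  move=> Kc jK ij; rewrite Q; apply/fintype.subsetP => k.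
  rewrite finset.in_setI finset.in_setU.
  move=> /andP[kK /orP[kb|//]]; move: kb; rewrite inE => /andP[_ ki].
  by have := component_side lin Kc kK jK ki; rewrite ij.
have disj : [disjoint before pos i & after pos i].
  rewrite -finset.setI_eq0; apply/eqP/setP => j; rewrite !inE.
  by apply/negP => /andP[/andP[_ ji] /andP[_]]; rewrite ltnNge ltnW.
(* The two sides are disjoint, so the inclusions and the covering force equality. *)
have cut K K' : K :&: (S :\ i) \subset before pos i ->
    K' :&: (S :\ i) \subset after pos i -> S :\ i \subset K :|: K' ->
    K :&: (S :\ i) = before pos i /\ K' :&: (S :\ i) = after pos i.
  move=> Kb K'a QKK'; split; apply/eqP; rewrite finset.eqEsubset ?Kb ?K'a /=;
    apply/fintype.subsetP => j jX.
    have jQ : j \in S :\ i by rewrite Q finset.in_setU jX.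
    rewrite finset.in_setI jQ andbT; have := fintype.subsetP QKK' j jQ.
    rewrite finset.in_setU => /orP[//|jK'].
    have ja : j \in after pos i by apply: (fintype.subsetP K'a); rewrite finset.in_setI jK'.
    by have := disjointFr disj jX; rewrite ja.
  have jQ : j \in S :\ i by rewrite Q finset.in_setU jX orbT.
  rewrite finset.in_setI jQ andbT; have := fintype.subsetP QKK' j jQ.
  rewrite finset.in_setU => /orP[jK|//].
  have jb : j \in before pos i by apply: (fintype.subsetP Kb); rewrite finset.in_setI jK.
  by have := disjointFr disj jb; rewrite jX.
have [j jb] := set0Pn _ b0; have [k ka] := set0Pn _ a0.
have jS : (pos j < pos i)%N by move: jb; rewrite inE => /andP[].
have kS : (pos i < pos k)%N by move: ka; rewrite inE => /andP[].
have jQ : j \in Km :|: Kp by apply: (fintype.subsetP QK); rewrite Q finset.in_setU jb.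
have kQ : k \in Km :|: Kp by apply: (fintype.subsetP QK); rewrite Q finset.in_setU ka orbT.
move: jQ kQ; rewrite !finset.in_setU => /orP[jK|jK] /orP[kK|kK].
- by have := component_side lin Kmc jK kK jS; rewrite kS.
- by left; apply: cut (sideQ _ _ Kmc jK jS) (sideQ' _ _ Kpc kK kS) QK.
- right; rewrite finset.setUC in QK.
  by have [] := cut _ _ (sideQ _ _ Kpc jK jS) (sideQ' _ _ Kmc kK kS) QK.
- by have := component_side lin Kpc jK kK jS; rewrite kS.
Qed.

Lemma traces_exist pos i : linear_arrangement pos -> i \in S ->
  exists Cm Cp, is_traces d rho2 rho3 S i Cm Cp.
Proof.
move=> lin iS; have [inj _ _] := lin; rewrite /is_traces (single_component lin iS).
case: (boolP (_ || _)) => [_|]; first by exists (S :\ i), finset.set0.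
rewrite negb_or => /andP[b0 a0].
have [Km Kmc bK] := before_component lin iS b0.
have [Kp Kpc aK] := after_component lin iS a0.
exists (Km :&: (S :\ i)), (Kp :&: (S :\ i)), Km, Kp; split => //.
by rewrite (before_afterE i inj) finset.setUSS.
Qed.

End Traces.
(** The two failing runs are excluded by [traces_exist] and [next_in_chain]. A completed run fixes
    the order only up to reversal, whence [pos']. *)
Lemma pines_ordered_cells pos p0 p : linear_arrangement pos ->
  pines d rho1 rho2 rho3 p0 p ->
  exists S B pos', [/\ is_cells d rho1 S B,
    pos' = pos \/ pos' = @rev_ord n \o pos
  & {in S &, forall a b, (pos' a < pos' b)%N ->
      forall j k, j \in B a -> k \in B b -> (p j < p k)%N}].
Proof.
move=> lin; have [inj _ _] := lin.
have inj' : injective (@rev_ord n \o pos) by exact: inj_comp rev_ord_inj inj.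
case=> {p} [S B i /maxsetP[packing _] _ iS none
    |S B Cm Cp s /maxsetP[packing _] cells tr ch size_s stuck
    |S B Cm Cp s p /maxsetP[packing _] cells tr ch size_s ranked].
- by have [Cm [Cp /none]] := traces_exist packing lin iS.
- exfalso.
  have spl : {in S, forall i, splits S pos i (Cm i) (Cp i)}.
    by move=> i iS; have [] := traces_split packing lin iS (tr i iS).
  have spl' : {in S, forall i, splits S (@rev_ord n \o pos) i (Cm i) (Cp i)}.
    by move=> i iS; exact/splits_rev/spl.
  suff [i] : exists i, eligible S Cm Cp s i by rewrite (negbTE (stuck i)).
  have [s0|s0] := eqVneq s [::]; last first.
    case: (chain_sorted inj spl ch) => [/eqP|pre|pre].
    + by rewrite (negbTE s0).
    + exact: next_in_chain pre size_s.
    + exact: next_in_chain pre size_s.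
  move: size_s; rewrite s0 card_gt0 => /set0Pn[j jS].
  (* For an empty chain, the first element of [S] along [pos] is eligible, as nothing precedes
     it. *)
  case: (@arg_minnP _ j (mem S) (fun x => pos x) jS) => m /= mS m_min.
  exists m; rewrite /eligible mS /=.
  have [_ ->//] := traces_split packing lin mS (tr m mS).
  apply/orP; left; apply/eqP/setP => k; rewrite !inE; apply/negP => /andP[kS].
  by rewrite ltnNge m_min.
have spl : {in S, forall i, splits S pos i (Cm i) (Cp i)}.
  by move=> i iS; have [] := traces_split packing lin iS (tr i iS).
have ordered pos' : sorted_prefix S pos' s ->
    {in S &, forall a b, (pos' a < pos' b)%N ->
      forall j k, j \in B a -> k \in B b -> (p j < p k)%N}.
  move=> [sS s_lt _] a b aS bS ab j k jB kB.
  have us : uniq s by apply: (pairwise_uniq _ s_lt) => x; rewrite ltnn.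
  have Ss x : x \in S -> x \in s.
    have : [set y in s] == S.
      rewrite finset.eqEcard cardsE (card_uniqP us) size_s leqnn andbT.
      by apply/fintype.subsetP => y; rewrite inE => /sS.
    by move=> /eqP <-; rewrite inE.
  have [as_ bs] := (Ss a aS, Ss b bS).
  have ia : (index a s < index b s)%N.
    rewrite ltnNge; apply/negP; rewrite leq_eqVlt => /orP[/eqP e|ba].
      have ab' : a = b by rewrite -(nth_index a as_) -e nth_index.
      by rewrite ab' ltnn in ab.
    have := pairwiseP a s_lt (index b s) (index a s).
    rewrite !inE !index_mem !nth_index// => /(_ bs as_ ba) => ba'.
    by have := ltn_trans ab ba'; rewrite ltnn.
  have := pairwiseP a ranked (index a s) (index b s).
  rewrite !inE !index_mem !nth_index// => /(_ as_ bs ia).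
  by move=> /forall_inP/(_ j jB)/forall_inP/(_ k kB).
case: (chain_sorted inj spl ch) => [s0|/ordered ord|/ordered ord].
- exists S, B, pos; split=> //; first by left.
  move=> a b aS; move: size_s; rewrite s0 => /esym/cards0_eq S0.
  by rewrite S0 inE in aS.
- by exists S, B, pos; split=> //; left.
- by exists S, B, (@rev_ord n \o pos); split=> //; right.
Qed.

Section Displacement.
Variables (S : {set 'I_n}) (B : 'I_n -> {set 'I_n}) (r : R).
Hypothesis cover : forall u, exists2 a, a \in S & u \in B a.
Hypothesis radius : forall a u, a \in S -> u \in B a -> D a u <= r.

(** An inversion [w] lies beyond [u] but is ranked earlier, so the center [b] of its cell does not
    lie after the center [a] of the cell of [u]. Comparing [w] with [a] yields
    [D u w <= (1 + alpha) * r]; as [v] lies between [u] and [w] or equals [w], one more factor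
    [alpha] suffices. *)
Lemma displacement_lt pos (p : 'I_n -> 'I_n) u v :
  linear_arrangement pos -> injective p ->
  {in S &, forall a b, (pos a < pos b)%N ->
    forall j k, j \in B a -> k \in B b -> (p j < p k)%N} ->
  pos v = p u -> (pos u < p u)%N -> D u v <= alpha * (1 + alpha) * r.
Proof.
move=> lin ip ordered vE pu; have [ipos mono _] := lin.
have [w pw wp] := exists_inversion ipos ip pu.
have Dge0 i j : 0 <= D i j.
  by have := Dtri i i j; have := Dtri i j i; rewrite (Dsym j i); lra.
have [a aS ua] := cover u; have [b bS wb] := cover w.
have Dau := radius aS ua; have Dbw := radius bS wb.
have r0 : 0 <= r by exact: le_trans (Dge0 _ _) Dau.
have uw : (pos u < pos w)%N by exact: leq_trans pu pw.
have ba : (pos b <= pos a)%N.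
  rewrite leqNgt; apply/negP => /(ordered a b aS bS) /(_ _ _ ua wb).
  by rewrite ltnNge ltnW.
have a1 := alpha_ge1.
have Duw : D u w <= (1 + alpha) * r.
  move: ba; rewrite leq_eqVlt => /orP[/eqP/val_inj/ipos e|ba].
    by subst b; have := Dtri u a w; rewrite (Dsym u a); nra.
  have [wa|aw|/val_inj/ipos e] := ltngtP (pos w) (pos a).
  - by have [H _] := mono _ _ _ uw wa; rewrite (Dsym u a) in H; nra.
  - have [_ H] := mono _ _ _ ba aw; have := Dtri u a w; rewrite (Dsym u a); nra.
  - by subst a; rewrite Dsym; nra.
have {}Duw : alpha * D u w <= alpha * ((1 + alpha) * r) by rewrite ler_wpM2l//; lra.
rewrite -mulrA; apply: le_trans _ Duw.
move: pw; rewrite -vE leq_eqVlt => /orP[/eqP/val_inj/ipos ->|vw].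
  by have := Dge0 u w; nra.
by have [] := mono u v w _ vw; rewrite ?vE.
Qed.

Lemma displacement pos (p : 'I_n -> 'I_n) u v :
  linear_arrangement pos -> injective p ->
  {in S &, forall a b, (pos a < pos b)%N ->
    forall j k, j \in B a -> k \in B b -> (p j < p k)%N} ->
  pos v = p u -> D u v <= alpha * (1 + alpha) * r.
Proof.
move=> lin ip ordered vE.
have [pu|pu|/val_inj pu] := ltngtP (pos u) (p u).
- exact: displacement_lt vE pu.
(* Reversing positions and ranks together reduces this case to the previous one. *)
- apply: (displacement_lt (linear_arrangement_rev lin) (inj_comp (@rev_ord_inj n) ip)) => /=.
  + move=> a b aS bS /= ab j k ja kb.
    have ba : (pos b < pos a)%N.
      by have := ltn_ord (pos a); have := ltn_ord (pos b); lia.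
    have := ordered _ _ bS aS ba _ _ kb ja.
    by have := ltn_ord (p j); have := ltn_ord (p k); lia.
  + by rewrite vE.
  + by have := ltn_ord (p u); have := ltn_ord (pos u); lia.
- have [ipos _ _] := lin; have uv : u = v by apply: ipos; rewrite vE.
  have [a aS ua] := cover u; have Dau := radius aS ua; have a1 := alpha_ge1.
  have D0 : 0 <= D a u by have := Dtri a a u; have := Dtri a u a; rewrite (Dsym u a); lra.
  have Du : D u u <= r + r by have := Dtri u a u; rewrite (Dsym u a); lra.
  have r0 : 0 <= r by lra.
  have a2 : 2 <= alpha * (1 + alpha) by nra.
  by rewrite -uv; apply: le_trans Du _; rewrite -mulr2n -mulr_natl ler_wpM2r.
Qed.

End Displacement.

Lemma pines_displacement pos p0 p : linear_arrangement pos ->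
  pines d rho1 rho2 rho3 p0 p ->
  exists2 pos', pos' = pos \/ pos' = @rev_ord n \o pos
  & forall u v, pos' v = p u -> D u v <= alpha * (1 + alpha) * (rho1 + eps).
Proof.
move=> lin /(pines_ordered_cells lin)[S [B [pos' [cells pos'E ordered]]]].
exists pos' => // u v; case: cells => cov _ rad.
apply: displacement ordered => //.
- move=> x; have : x \in [set: 'I_n] by rewrite inE.
  by rewrite -cov => /finset.bigcupP[a aS xa]; exists a.
- move=> a x aS xa; have [_ /fintype.subsetP/(_ x xa)] := rad a aS.
  by rewrite inE => dax; have [_ le] := dD_le a x; lra.
- by case: pos'E => ->//; exact: linear_arrangement_rev.
- exact: perm_inj.
Qed.

End PinesCorrectness.

(** * Accuracy of the estimated distance *)

Section EuclideanNorm.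
Context (R : realType) (I : finType).
Implicit Types a b : I -> R.

Lemma sum_sqr_ge0 a : 0 <= \sum_k a k ^+ 2.
Proof. by apply: sumr_ge0 => k _; exact: sqr_ge0. Qed.

Lemma sqrt_sum_sqr_triangle a b :
  Num.sqrt (\sum_k (a k + b k) ^+ 2) <=
  Num.sqrt (\sum_k a k ^+ 2) + Num.sqrt (\sum_k b k ^+ 2).
Proof.
set s := Num.sqrt (\sum_k a k ^+ 2); set t := Num.sqrt (\sum_k b k ^+ 2).
have s0 : 0 <= s := sqrtr_ge0 _; have t0 : 0 <= t := sqrtr_ge0 _.
have s2 : s ^+ 2 = \sum_k a k ^+ 2 by rewrite sqr_sqrtr ?sum_sqr_ge0.
have t2 : t ^+ 2 = \sum_k b k ^+ 2 by rewrite sqr_sqrtr ?sum_sqr_ge0.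
have vanish c : \sum_k c k ^+ 2 = 0 :> R -> forall k : I, c k = 0.
  move=> c0 k; apply/eqP; rewrite -sqrf_eq0; apply/eqP.
  by apply: (psumr_eq0P _ c0) => // j _; exact: sqr_ge0.
rewrite -(ger0_norm (addr_ge0 s0 t0)) -sqrtr_sqr ler_sqrt ?sqr_ge0//.
(* Zero norms are treated apart, since the weights below divide by [s] and [t]. *)
have [/eqP s00|sn0] := eqVneq s 0.
  have a0 := vanish a; rewrite -s2 (eqP s00) expr0n /= in a0.
  by rewrite (eqP s00) add0r t2; under eq_bigr do rewrite a0// add0r.
have [/eqP t00|tn0] := eqVneq t 0.
  have b0 := vanish b; rewrite -t2 (eqP t00) expr0n /= in b0.
  by rewrite (eqP t00) addr0 s2; under eq_bigr do rewrite b0// addr0.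
have sp : 0 < s by rewrite lt0r sn0.
have tp : 0 < t by rewrite lt0r tn0.
(* AM-GM: 2 a b <= (t / s) a^2 + (s / t) b^2 *)
apply: (@le_trans _ _ (\sum_k ((1 + t / s) * a k ^+ 2 + (1 + s / t) * b k ^+ 2))).
  apply: ler_sum => k _.
  rewrite -subr_ge0 (_ : _ - _ = s * t * (a k / s - b k / t) ^+ 2); last first.
    by field; rewrite ?sn0 ?tn0.
  by rewrite mulr_ge0 ?sqr_ge0// mulr_ge0.
rewrite big_split /= -!mulr_sumr -s2 -t2.
by rewrite (_ : _ + _ = (s + t) ^+ 2)//; field; rewrite ?sn0 ?tn0.
Qed.

End EuclideanNorm.

Lemma ler_dist_shift (R : realType) (a b c e r s : R) :
  `|a - c| <= r -> `|b - e| <= r -> `|a - b| <= s -> `|c - e| <= s + 2 * r.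
Proof.
rewrite !ler_norml => /andP[? ?] /andP[? ?] /andP[? ?].
by apply/andP; split; lra.
Qed.

(** Truncation at 0 only brings [x] closer to [y ^+ 2]; and for nonnegative numbers a gap above [m]
    forces a gap above [m ^+ 2] between the squares. *)
Lemma dist_sqrt_le (R : rcfType) (x y m : R) : 0 <= y -> 0 <= m ->
  `|x - y ^+ 2| <= m ^+ 2 -> `|Num.sqrt (Num.max 0 x) - y| <= m.
Proof.
move=> y0 m0 xy; set z := Num.sqrt _.
have z0 : 0 <= z := sqrtr_ge0 _.
have z2 : z ^+ 2 = Num.max 0 x by rewrite sqr_sqrtr// le_max lexx.
have : `|z ^+ 2 - y ^+ 2| <= m ^+ 2.
  apply: le_trans xy; rewrite z2; case: (lerP x 0) => // x0.
  have y2 := sqr_ge0 y; rewrite sub0r normrN ger0_norm// distrC ger0_norm; lra.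
have zm : 0 <= z * m by exact: mulr_ge0.
have ym : 0 <= y * m by exact: mulr_ge0.
rewrite !ler_norml => /andP[h1 h2].
have h3 : y <= z + m.
  by rewrite -(@ler_pXn2r _ 2) ?nnegrE ?addr_ge0// sqrrD; lra.
have h4 : z <= y + m.
  by rewrite -(@ler_pXn2r _ 2) ?nnegrE ?addr_ge0// sqrrD; lra.
by apply/andP; split; lra.
Qed.

Section DistanceEstimate.
Context (R : realType) (n : nat) (A q : R) (X E : 'M[R]_n).
Implicit Types i j k : 'I_n.

Definition row_sqr i : R := \sum_k X i k ^+ 2.

Definition row_distance i j : R := Num.sqrt (\sum_k (X i k - X j k) ^+ 2).

Lemma row_distance_sym i j : row_distance i j = row_distance j i.
Proof. by congr Num.sqrt; apply: eq_bigr => k _; rewrite -sqrrN opprB. Qed.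

Lemma row_distance_triangle i j k :
  row_distance i k <= row_distance i j + row_distance j k.
Proof.
apply: le_trans (sqrt_sum_sqr_triangle _ _); rewrite ler_sqrt ?sum_sqr_ge0//.
by apply: ler_sum => l _; rewrite addrA subrK.
Qed.

Lemma row_distance_sqr i j :
  row_distance i j ^+ 2 = row_sqr i + row_sqr j - 2 * row_inner X i j.
Proof.
rewrite sqr_sqrtr ?sum_sqr_ge0// /row_sqr /row_inner mulr_sumr -big_split -sumrB /=.
by apply: eq_bigr => k _; ring.
Qed.

Hypothesis A_ge1 : 1 <= A.
Hypothesis q_ge0 : 0 <= q.
Hypothesis near : forall i, exists2 j, j != i &
  `|row_total X j - row_total X i| <= A /\
  row_sqr i - 3 / 2 * A ^+ 2 <= row_inner X i j.
Hypothesis sqr_total : forall i j,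
  row_sqr j - row_sqr i <= 2 * A * `|row_total X j - row_total X i|.
Hypothesis noise_total : forall i, `|row_total E i| <= 16 * q.
Hypothesis noise_cross : forall i j, `|\sum_k X i k * E j k| <= 16 * A * q.
Hypothesis noise_inner : forall i j, i != j -> `|row_inner E i j| <= 16 * q.

Variable Y : 'M[R]_n.
Hypothesis YE : Y = X + E.

Lemma row_innerC (M : 'M[R]_n) i j : row_inner M i j = row_inner M j i.
Proof. by apply: eq_bigr => k _; rewrite mulrC. Qed.

Lemma row_inner_noise i j : i != j ->
  `|row_inner Y i j - row_inner X i j| <= 48 * A * q.
Proof.
move=> ij.
have -> : row_inner Y i j - row_inner X i j =
    \sum_k X i k * E j k + \sum_k X j k * E i k + row_inner E i j.
  by rewrite YE /row_inner -!big_split -sumrB /=; apply: eq_bigr => k _; rewrite !mxE; ring.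
have := noise_cross i j; have := noise_cross j i; have := noise_inner ij.
(* Three noise terms of size at most [16 * A * q] make up the constant 48. *)
have qA : q <= A * q by have a1 := A_ge1; have q0 := q_ge0; nra.
rewrite !ler_norml => /andP[? ?] /andP[? ?] /andP[? ?].
by apply/andP; split; lra.
Qed.

Lemma row_total_noise i : `|row_total Y i - row_total X i| <= 16 * q.
Proof.
rewrite (_ : _ - _ = row_total E i)// YE /row_total -sumrB.
by apply: eq_bigr => k _; rewrite !mxE addrAC subrr add0r.
Qed.

Hypothesis qE : q = Num.sqrt (n%:R * ln n%:R).

(** Above: an inner product is at most the mean of the two squared norms, and a candidate's squared
    norm exceeds [row_sqr i] by at most [2 A] times the gap of the true row sums, itself at most
    [32 * (A + q) + 32 * q]. Below: the neighbour given by [near] is a candidate, since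
    [A + 32 * q <= 32 * (A + q)]. *)
Lemma self_inner_close i :
  `|self_inner 32 A Y i - row_sqr i| <= 64 * A ^+ 2 + 112 * A * q.
Proof.
have cand j : (j \in candidates 32 A Y i) =
    (j != i) && (`|row_total Y j - row_total Y i| <= 32 * (A + q)).
  by rewrite inE qE.
have upper j : j \in candidates 32 A Y i ->
    row_inner Y i j <= row_sqr i + 64 * A ^+ 2 + 112 * A * q.
  rewrite cand => /andP[ji]; have ij : i != j by rewrite eq_sym.
  move=> /(ler_dist_shift (row_total_noise j) (row_total_noise i)) tot.
  have := sqr_total i j; have := row_distance_sqr i j.
  have := sqr_ge0 (row_distance i j); have := row_inner_noise ij.
  have : 2 * A * `|row_total X j - row_total X i| <=
      2 * A * (32 * (A + q) + 2 * (16 * q)).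
    by rewrite ler_wpM2l// mulr_ge0// (le_trans ler01).
  have AA : 0 <= A ^+ 2 by exact: sqr_ge0.
  by rewrite ler_norml => ? /andP[? ?] ? ? ?; lra.
have [j ji [tot inn]] := near i.
have jc : j \in candidates 32 A Y i.
  have rtn k : `|row_total X k - row_total Y k| <= 16 * q.
    by rewrite distrC row_total_noise.
  rewrite cand ji /=; apply: le_trans (ler_dist_shift (rtn j) (rtn i) tot) _.
  by have a1 := A_ge1; lra.
have lower : row_inner Y i j <= self_inner 32 A Y i.
  rewrite /self_inner; case: pickP => [j0 _|/(_ j)]; last by rewrite jc.
  exact: le_bigmax_cond.
have up : self_inner 32 A Y i <= row_sqr i + 64 * A ^+ 2 + 112 * A * q.
  rewrite /self_inner; case: pickP => [j0 j0c|/(_ j)]; last by rewrite jc.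
  by apply: bigmax_le; [exact: upper|move=> k kc; exact: upper].
have := row_inner_noise (i := i) (j := j); rewrite eq_sym ji => /(_ isT).
rewrite !ler_norml => /andP[h1 h2].
have Aq : 0 <= A * q by have a1 := A_ge1; have q0 := q_ge0; nra.
have AA : 0 <= A ^+ 2 by exact: sqr_ge0.
by apply/andP; split; lra.
Qed.

(** The squared distances differ by at most [128 A^2 + 320 A q], which is below the square of the
    right-hand side, hence the constant 20. *)
Lemma dhat_close i j :
  `|dhat 32 A Y i j - row_distance i j| <= 20 * (A + Num.sqrt A * Num.sqrt q).
Proof.
have A0 : 0 <= A by exact: le_trans ler01 A_ge1.
have sq2 : (Num.sqrt A * Num.sqrt q) ^+ 2 = A * q by rewrite exprMn !sqr_sqrtr.
have p0 : 0 <= Num.sqrt A * Num.sqrt q by rewrite mulr_ge0 ?sqrtr_ge0.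
have e0 : 0 <= 20 * (A + Num.sqrt A * Num.sqrt q) by lra.
rewrite mxE; have [<-|ij] := eqVneq i j.
  rewrite /row_distance big1 ?sqrtr0 ?subrr ?normr0// => k _.
  by rewrite subrr expr0n.
apply: dist_sqrt_le => //; first exact: sqrtr_ge0.
rewrite row_distance_sqr.
have := self_inner_close i; have := self_inner_close j; have := row_inner_noise ij.
rewrite !ler_norml => /andP[h1 h2] /andP[h3 h4] /andP[h5 h6].
set p := Num.sqrt A * Num.sqrt q in p0 sq2 e0 *.
have Aq : 0 <= A * q by rewrite mulr_ge0.
by apply/andP; split; nra.
Qed.

End DistanceEstimate.

(** * Loss of a permutation with small displacement *)

Section Ell2.
Context (R : realType) (n : nat).
Implicit Types (X Q : 'M[R]_n) (s : {perm 'I_n}).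

Lemma frob_norm_ge0 X : 0 <= frob_norm X.
Proof. exact: sqrtr_ge0. Qed.

Lemma ell2_has_lbound X s :
  has_lbound [set frob_norm (perm_act s X - Q) | Q in robinson]%classic.
Proof. by exists 0 => _ [Q _ <-]; exact: frob_norm_ge0. Qed.

Lemma robinson0 : robinson (0 : 'M[R]_n).
Proof. by split; [exact: trmx0|move=> *; rewrite !mxE|move=> *; rewrite !mxE]. Qed.

Lemma ell2_le X s Q : robinson Q -> ell2 X s <= frob_norm (perm_act s X - Q).
Proof. by move=> rQ; apply: ge_inf; [exact: ell2_has_lbound|exists Q]. Qed.

Lemma ell2_ge0 X s : 0 <= ell2 X s.
Proof.
apply: lb_le_inf => [|_ [Q _ <-]]; last exact: frob_norm_ge0.
by exists (frob_norm (perm_act s X - 0)); exists 0 => //; exact: robinson0.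
Qed.

Lemma sum_perm s (F : 'I_n -> R) : \sum_i F (s i) = \sum_i F i.
Proof. by rewrite [RHS](reindex_inj (@perm_inj _ s)). Qed.

Lemma ell2_le_max X s (A : R) : 0 <= A ->
  (forall i j, 0 <= X i j <= A) -> ell2 X s <= n%:R * A.
Proof.
move=> A0 XA.
apply: le_trans (ell2_le _ _ robinson0) _; rewrite subr0 /frob_norm.
rewrite -[leRHS]ger0_norm ?mulr_ge0// -sqrtr_sqr ler_sqrt ?sqr_ge0//.
apply: (@le_trans _ _ (\sum_(i < n) \sum_(j < n) A ^+ 2)).
  apply: ler_sum => i _; apply: ler_sum => j _; rewrite mxE.
  by have /andP[x0 xA] := XA ((s^-1)%g i) ((s^-1)%g j); rewrite ler_sqr ?nnegrE.
by rewrite !sumr_const !card_ord -mulrnA -(mulr_natl (A ^+ 2)) natrM exprMn -expr2.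
Qed.

(** Rows and then columns of [X] are displaced by [v]. By symmetry either move costs at most [n K^2]
    in squared norm, and [(a - c)^2 <= 2 (a - b)^2 + 2 (b - c)^2] gives the factor 2. *)
Lemma ell2_le_displacement X Q s (v : 'I_n -> 'I_n) (K : R) : 0 <= K ->
  robinson Q -> X^T = X -> injective v ->
  (forall i j, Q (s i) (s j) = X (v i) (v j)) ->
  (forall i, row_distance X i (v i) <= K) ->
  ell2 X s <= 2 * Num.sqrt n%:R * K.
Proof.
move=> K0 rQ XT vinj QE vK; apply: le_trans (ell2_le _ _ rQ) _.
have symX i j : X i j = X j i by rewrite -[in LHS]XT mxE.
have rowK : \sum_i \sum_j (X i j - X (v i) j) ^+ 2 <= n%:R * K ^+ 2.
  rewrite mulr_natl -[n in leRHS]card_ord -sumr_const; apply: ler_sum => i _.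
  have : row_distance X i (v i) ^+ 2 <= K ^+ 2.
    by rewrite ler_sqr ?nnegrE ?sqrtr_ge0.
  by rewrite sqr_sqrtr ?sum_sqr_ge0.
have colK : \sum_i \sum_j (X (v i) j - X (v i) (v j)) ^+ 2 <= n%:R * K ^+ 2.
  apply: le_trans rowK; rewrite exchange_big /=; apply: ler_sum => j _.
  rewrite [leRHS](reindex_inj vinj) /=.
  by apply: ler_sum => i _; rewrite (symX j) (symX (v j)).
have nK : 0 <= 2 * Num.sqrt n%:R * K by rewrite !mulr_ge0 ?sqrtr_ge0.
rewrite -[leRHS]ger0_norm// -sqrtr_sqr ler_sqrt ?sqr_ge0//.
rewrite !exprMn sqr_sqrtr ?ler0n//.
rewrite -(sum_perm s); under eq_bigr do rewrite -(sum_perm s).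
apply: (@le_trans _ _ (\sum_i \sum_j (2 * (X i j - X (v i) j) ^+ 2 +
    2 * (X (v i) j - X (v i) (v j)) ^+ 2))).
  apply: ler_sum => i _; apply: ler_sum => j _.
  rewrite [(_ - Q) _ _]mxE perm_actE mxE QE.
  set a := X i j; set b := X (v i) j; set c := X (v i) (v j).
  have := sqr_ge0 (a - b - (b - c)); rewrite -subr_ge0 => h.
  rewrite -subr_ge0; apply: le_trans h _.
  by rewrite le_eqVlt; apply/orP; left; apply/eqP; ring.
under eq_bigr do rewrite big_split -!mulr_sumr /=.
rewrite big_split -!mulr_sumr /=; lra.
Qed.

End Ell2.

(** * The permuted Toeplitz signal *)

Section Model.
Context (R : realType) (n : nat) (A : R) (theta : n.-tuple R) (pistar : {perm 'I_n}).
Hypothesis A_ge0 : 0 <= A.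
Hypothesis theta_bounds : forall i : 'I_n, 0 <= tnth theta i <= A.
Hypothesis theta_anti : forall i j : 'I_n, (i <= j)%N -> tnth theta j <= tnth theta i.

(* Past the end of [theta], [nth] returns 0, so that [profile] is monotone
   on all of [nat]. *)
Definition profile (l : nat) : R := theta`_l.

Definition latent (o : 'I_n) : 'I_n := (pistar^-1)%g o.

Let X := perm_act pistar (toeplitz theta).

Lemma profile_ord (l : 'I_n) : profile l = tnth theta l.
Proof. by rewrite (tnth_nth 0). Qed.

Lemma profile_default l : (n <= l)%N -> profile l = 0.
Proof. by move=> nl; rewrite /profile nth_default// size_tuple. Qed.

Lemma profile_bounds l : 0 <= profile l <= A.
Proof.
have [ln|/profile_default->] := ltnP l n; last by rewrite lexx.
by rewrite (profile_ord (Ordinal ln)).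
Qed.

Lemma profile_ge0 l : 0 <= profile l. Proof. by have /andP[] := profile_bounds l. Qed.

Lemma profile_le l : profile l <= A. Proof. by have /andP[] := profile_bounds l. Qed.

Lemma profile_anti i j : (i <= j)%N -> profile j <= profile i.
Proof.
move=> ij; have [jn|/profile_default->] := ltnP j n; last exact: profile_ge0.
rewrite (profile_ord (Ordinal jn)) (profile_ord (Ordinal (leq_ltn_trans ij jn))).
exact: theta_anti.
Qed.

Lemma toeplitzE (i j : 'I_n) : toeplitz theta i j = profile (gap i j).
Proof. by rewrite mxE. Qed.

Lemma signalE i j : X i j = profile (gap (latent i) (latent j)).
Proof. by rewrite !mxE. Qed.

Lemma signal_sym : X^T = X.
Proof. by apply/matrixP => i j; rewrite mxE !signalE gap_sym. Qed.

Lemma latentK o : latent (pistar o) = o.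
Proof. exact: permK. Qed.

Lemma latent_inj : injective latent.
Proof. exact: perm_inj. Qed.

Lemma robinson_toeplitz : robinson (toeplitz theta).
Proof.
split.
- by apply/matrixP => i j; rewrite mxE !toeplitzE gap_sym.
- by move=> i j k jk ki; rewrite !toeplitzE; apply: profile_anti; rewrite /gap; lia.
- by move=> i j k ij jk; rewrite !toeplitzE; apply: profile_anti; rewrite /gap; lia.
Qed.

Lemma row_total_signal i : row_total X i = row_sum n profile (latent i).
Proof.
rewrite /row_total -(sum_perm pistar); apply: eq_bigr => k _.
by rewrite signalE latentK.
Qed.

Lemma row_sqr_signal i : row_sqr X i = row_sum n (fun l => profile l ^+ 2) (latent i).
Proof.
rewrite /row_sqr -(sum_perm pistar); apply: eq_bigr => k _.
by rewrite signalE latentK.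
Qed.

Lemma row_distance_signal i j :
  row_distance X i j = Num.sqrt (row_dist2 n profile (latent i) (latent j)).
Proof.
congr Num.sqrt; rewrite -(sum_perm pistar); apply: eq_bigr => k _.
by rewrite !signalE latentK.
Qed.

Lemma signal_arrangement :
  linear_arrangement (row_distance X) (Num.sqrt 2) (Num.sqrt 2 * A) latent.
Proof.
have le2 a b : a <= 2 * b -> Num.sqrt a <= Num.sqrt 2 * Num.sqrt b :> R.
  move=> ab; rewrite -sqrtrM//; have [b0|b0] := leP 0 (2 * b).
    by rewrite ler_sqrt.
  by rewrite ler0_sqrtr ?sqrtr_ge0//; lra.
split; first exact: latent_inj.
- move=> i j k ij jk; rewrite !row_distance_signal; split; apply: le2.
  + exact: (row_dist2_monol profile_anti ij jk).
  + exact: (row_dist2_monor profile_anti ij jk).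
- move=> i j ij; rewrite row_distance_signal ij.
  rewrite -[X in _ * X]ger0_norm// -sqrtr_sqr; apply: le2.
  by apply: (row_dist2_step profile_anti profile_ge0 profile_le); rewrite -ij.
Qed.

(** For a latent neighbour the inner product is half of [|X_i|^2 + |X_j|^2 - D^2]; the norm term
    costs [A^2] and the distance [2 A^2], whence [3 / 2]. *)
Lemma signal_near i : (1 < n)%N -> exists2 j, j != i &
  `|row_total X j - row_total X i| <= A /\
  row_sqr X i - 3 / 2 * A ^+ 2 <= row_inner X i j.
Proof.
move=> n1.
have adjacent j :
  latent j = (latent i).+1 :> nat \/ latent i = (latent j).+1 :> nat ->
  exists2 j, j != i &
  `|row_total X j - row_total X i| <= A /\
  row_sqr X i - 3 / 2 * A ^+ 2 <= row_inner X i j.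
  move=> ij; exists j; first by apply/eqP => e; rewrite e in ij; lia.
  have [_ _ step] := signal_arrangement.
  have Dij : row_distance X i j <= Num.sqrt 2 * A.
    by case: ij => /step//; rewrite row_distance_sym.
  have D2 : row_distance X i j ^+ 2 <= 2 * A ^+ 2.
    rewrite -[2 in leRHS]sqr_sqrtr// -exprMn.
    by rewrite ler_sqr ?nnegrE ?sqrtr_ge0// mulr_ge0 ?sqrtr_ge0.
  rewrite row_distance_sqr in D2.
  have [tot nrm] : `|row_total X j - row_total X i| <= A /\
      `|row_sqr X j - row_sqr X i| <= A ^+ 2.
    rewrite !row_total_signal !row_sqr_signal.
    case: ij => ij; [|rewrite distrC [X in _ /\ X <= _]distrC]; rewrite ij; split.
    - by apply: (row_sum_step_le profile_ge0 profile_le); rewrite -ij.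
    - by apply: (row_sum_sqr_step_le profile_ge0 profile_le); rewrite -ij.
    - by apply: (row_sum_step_le profile_ge0 profile_le); rewrite -ij.
    - by apply: (row_sum_sqr_step_le profile_ge0 profile_le); rewrite -ij.
  split; first exact: tot.
  by move: nrm; rewrite ler_norml => /andP[? ?]; lra.
have [un|nu] := ltnP (latent i).+1 n.
  by apply: (adjacent (pistar (Ordinal un))); left; rewrite latentK.
(* The last object has no successor and uses its predecessor. *)
have un : ((latent i).-1 < n)%N by have := ltn_ord (latent i); lia.
apply: (adjacent (pistar (Ordinal un))); right; rewrite latentK /=.
by have := ltn_ord (latent i); lia.
Qed.

Lemma signal_sqr_total i j :
  row_sqr X j - row_sqr X i <= 2 * A * `|row_total X j - row_total X i|.
Proof.
rewrite !row_total_signal !row_sqr_signal.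
exact: (row_sum_sqr_le profile_anti profile_ge0 profile_le).
Qed.

Lemma signal_bounds i j : 0 <= X i j <= A.
Proof. by rewrite signalE profile_bounds. Qed.

Lemma pines_ell2 (d : 'M[R]_n) (eps : R) (pi0 p : {perm 'I_n}) :
  let alpha := Num.sqrt 2 in
  let delta := Num.sqrt 2 * A in
  let rho3 := delta + eps in
  let rho2 := alpha * delta + 2 * (1 + alpha) * eps in
  let rho1 := alpha ^+ 2 * delta + (2 * alpha ^+ 2 + 3 * alpha + 2) * eps in
  (forall i j, d i j = d j i) -> (forall i, d i i = 0) ->
  (forall i j, `|d i j - row_distance X i j| <= eps) -> 0 <= eps ->
  pines d rho1 rho2 rho3 pi0 p ->
  ell2 X p <= 2 * Num.sqrt n%:R * (alpha * (1 + alpha) * (rho1 + eps)).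
Proof.
move=> alpha delta rho3 rho2 rho1 dsym d0 dD e0 pin.
have a1 : 1 <= alpha by rewrite -sqrtr1 ler_sqrt// ler1n.
have de0 : 0 <= delta by rewrite mulr_ge0 ?sqrtr_ge0.
have [pos' pos'E disp] := pines_displacement (@row_distance_sym _ _ X)
  (@row_distance_triangle _ _ X) dsym d0 dD a1 de0 e0 signal_arrangement pin.
have r0 : 0 <= rho1 by rewrite /rho1; nra.
have K0 : 0 <= alpha * (1 + alpha) * (rho1 + eps) by rewrite !mulr_ge0//; lra.
(* The object [v u] occupies the place assigned to [u], in the latent order or its reverse; gaps are
   the same for both, so the comparison matrix is [toeplitz theta] either way. *)
have [v vE gapE] : exists2 v, (forall u, pos' (v u) = p u) &
    forall i j, gap (latent (v i)) (latent (v j)) = gap (p i) (p j).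
  case: pos'E => ->.
    by exists (fun u => pistar (p u)) => [u|i j]; rewrite !latentK.
  exists (fun u => pistar (rev_ord (p u))) => [u|i j]; rewrite /= !latentK ?rev_ordK//.
  by rewrite /gap /=; have := ltn_ord (p i); have := ltn_ord (p j); lia.
apply: (ell2_le_displacement K0 robinson_toeplitz signal_sym (v := v)).
- by move=> i j e; apply: (@perm_inj _ p); rewrite -!vE e.
- by move=> i j; rewrite toeplitzE signalE gapE.
- by move=> i; exact: disp.
Qed.

End Model.

(** * Concentration of the noise *)

Lemma expR1_le4 (R : realType) : expR 1 <= 4 :> R.
Proof.
have h : 1 / 2 <= expR (- (1 / 2)) :> R.
  by apply: le_trans (expR_ge1Dx _); lra.
have h1 : expR (1 / 2) <= 2 :> R.
  have e : expR (1 / 2) * expR (- (1 / 2)) = 1 :> R by rewrite -expRD subrr expR0.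
  have p := expR_gt0 (1 / 2 : R); nra.
have -> : 1 = 1 / 2 + 1 / 2 :> R by lra.
have p := expR_gt0 (1 / 2 : R); rewrite expRD; nra.
Qed.

Section NoiseStatistics.
Context d (T : measurableType d) (R : realType) (P : probability T R) (n : nat).
Context (E : 'I_n -> 'I_n -> {RV P >-> R}) (a : option 'I_n -> 'I_n -> R).
Hypothesis indep : mutually_independent (fun ij : 'I_n * 'I_n => E ij.1 ij.2).
Hypothesis subgaussian : forall i j, subgaussian1 (E i j).
Hypothesis n_gt1 : (1 < n)%N.
Hypothesis a_le1 : forall o k, `|a o k| <= 1.

(* The theorem takes [a None = 1] and for [a (Some i)] the [i]-th row of the
   signal divided by [A], so that the three kinds of noise terms, row sums
   [inl (None, j)], [<X_i, E_j> / A] and [<E_i, E_j>], obey one threshold. *)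
Definition stat_index : finType := ((option 'I_n * 'I_n) + ('I_n * 'I_n))%type.

Definition noise_stat (x : stat_index) (w : T) : R :=
  match x with
  | inl (o, j) => \sum_k a o k * E j k w
  | inr (i, j) => if i == j then 0 else \sum_k E i k w * E j k w
  end.

Let N : R := n%:R.

(** Chosen so that the exponential moments are powers of [N], while its product with the threshold
    [16 sqrt (N ln N)] is [8 ln N]. *)
Definition chernoff : R := Num.sqrt (ln N / N) / 2.

(** A smooth substitute for the indicator that the statistic exceeds the threshold: it is then at
    least 1. *)
Definition stat_tail (x : stat_index) (w : T) : R :=
  expR (chernoff * noise_stat x w - 8 * ln N) +
  expR (- chernoff * noise_stat x w - 8 * ln N).

Definition noise_tail (w : T) : R := \sum_x stat_tail x w.

Lemma N_gt1 : 1 < N. Proof. by rewrite ltr1n. Qed.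

Lemma lnN_ge0 : 0 <= ln N. Proof. by rewrite ln_ge0// ltW// N_gt1. Qed.

Lemma lnN_le : ln N <= N.
Proof.
have n0 := N_gt1; apply: (@le_trans _ _ (N - 1)); last by lra.
rewrite -[in leLHS](subrKC 1 N); apply: le_ln1Dx; lra.
Qed.

Lemma chernoff_sqr : chernoff ^+ 2 * N = ln N / 4.
Proof.
have n0 := N_gt1; rewrite expr_div_n sqr_sqrtr ?divr_ge0 ?lnN_ge0 ?ler0n//.
by field; lra.
Qed.

Lemma chernoff_threshold : chernoff * (16 * Num.sqrt (N * ln N)) = 8 * ln N.
Proof.
have n0 := N_gt1; have l0 := lnN_ge0.
have : Num.sqrt (ln N / N) * Num.sqrt (N * ln N) = ln N.
  rewrite -sqrtrM ?divr_ge0 ?ler0n//.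
  rewrite (_ : ln N / N * (N * ln N) = ln N ^+ 2); last by field; lra.
  by rewrite sqrtr_sqr ger0_norm.
rewrite /chernoff; set u := Num.sqrt _; set v := Num.sqrt _ => uv.
by rewrite -uv; field.
Qed.

Lemma noise_stat_measurable x : measurable_fun setT (noise_stat x).
Proof.
case: x => [[r j]|[i j]]; rewrite /noise_stat.
  apply: measurable_sum_in => k _; exact: measurable_funM.
case: (i == j); first exact: measurable_cst.
by apply: measurable_sum_in => k _; exact: measurable_funM.
Qed.

(** The exponent is at most [t^2 N / 2 = ln N / 8] for linear statistics and
    [2 e t^2 N = e ln N / 2] for bilinear ones; [e <= 4] gives the common bound. *)
Lemma noise_stat_mgf x (t : R) : t ^+ 2 = chernoff ^+ 2 ->
  (\int[P]_w (expR (t * noise_stat x w))%:E <= (expR (2 * ln N))%:E)%E.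
Proof.
move=> t2; have l0 := lnN_ge0; have e4 := expR1_le4 R.
have tN : t ^+ 2 * N = ln N / 4 by rewrite t2 chernoff_sqr.
case: x => [[r j]|[i j]] /=.
  under eq_integral do rewrite mulr_sumr.
  pose c (ij : 'I_n * 'I_n) := t * a r ij.2.
  pose s := [seq (j, k) | k <- enum 'I_n].
  have us : uniq s by rewrite map_inj_uniq ?enum_uniq// => ? ? [].
  have := linear_mgf indep (fun ij => subgaussian ij.1 ij.2) c us.
  rewrite /s big_map big_enum /c /=.
  under eq_integral => w _.
    rewrite big_map big_enum /=; under eq_bigr do rewrite -mulrA; over.
  move=> /le_trans; apply; rewrite lee_fin ler_expR.
  apply: (@le_trans _ _ (\sum_(k < n) t ^+ 2 / 2)).
    apply: ler_sum => k _; rewrite exprMn ler_wpM2r//.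
    by rewrite -[leRHS]mulr1 ler_wpM2l ?sqr_ge0// -real_normK ?num_real// expr_le1.
  by rewrite sumr_const card_ord -mulr_natl -/N; lra.
have [ij|ij] := eqVneq i j.
  under eq_integral do rewrite mulr0 expR0.
  rewrite integral_probability_cst lee_fin.
  by apply: le_trans (expR_ge1Dx _); rewrite lerDl mulr_ge0.
have n0 := N_gt1.
have te : t ^+ 2 * expR 1 <= 1.
  have tn : t ^+ 2 <= 1 / 4.
    rewrite -(@ler_pM2r _ N); last by lra.
    by rewrite tN; have := lnN_le; lra.
  have t0 := sqr_ge0 t; have p := expR_gt0 (1 : R); nra.
have us : uniq (map (pair i) (enum 'I_n) ++ map (pair j) (enum 'I_n)).
  have um (l : 'I_n) : uniq (map (pair l) (enum 'I_n)).
    by rewrite map_inj_uniq ?enum_uniq// => ? ? [].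
  rewrite cat_uniq !um andbT /= -all_predC; apply/allP => _ /mapP[k _ ->] /=.
  by apply/mapP => -[l _ [ji _]]; rewrite ji eqxx in ij.
have := bilinear_mgf indep (fun ij => subgaussian ij.1 ij.2) te us.
under eq_integral => w _ do rewrite big_enum /=.
move=> /le_trans; apply; rewrite lee_fin ler_expR size_enum_ord -/N.
rewrite -mulrA tN; have p := expR_gt0 (1 : R); nra.
Qed.

Lemma stat_tail_integral x :
  (\int[P]_w (stat_tail x w)%:E <= (2 * expR (- (6 * ln N)))%:E)%E.
Proof.
have mt t : measurable_fun setT (fun w => expR (t * noise_stat x w)).
  apply: measurableT_comp => //; apply: measurable_funM => //.
  exact: noise_stat_measurable.
pose k : R := expR (- (8 * ln N)).
have k0 : 0 <= k := expR_ge0 _.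
have half t : t ^+ 2 = chernoff ^+ 2 ->
    (\int[P]_w (expR (t * noise_stat x w - 8 * ln N))%:E <=
     (expR (- (6 * ln N)))%:E)%E.
  move=> t2; under eq_integral do rewrite expRD mulrC EFinM.
  rewrite ge0_integralZl_EFin//; last exact/measurable_EFinP.
  apply: (le_trans (lee_wpmul2l _ (noise_stat_mgf x t2))); first by rewrite lee_fin.
  by rewrite -EFinM lee_fin -expRD ler_expR; lra.
have mh t : measurable_fun setT (fun w => (expR (t * noise_stat x w - 8 * ln N))%:E).
  apply/measurable_EFinP; apply: measurableT_comp => //; apply: measurable_funB => //.
  apply: measurable_funM => //; exact: noise_stat_measurable.
under eq_integral do rewrite EFinD.
rewrite ge0_integralD//.
rewrite (_ : 2 * _ = expR (- (6 * ln N)) + expR (- (6 * ln N))); last by lra.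
by rewrite EFinD leeD// half// sqrrN.
Qed.

Lemma stat_tail_ge0 x w : 0 <= stat_tail x w.
Proof. by rewrite addr_ge0 ?expR_ge0. Qed.

Lemma noise_tail_ge0 w : 0 <= noise_tail w.
Proof. by apply: sumr_ge0 => x _; exact: stat_tail_ge0. Qed.

Lemma stat_tail_measurable x : measurable_fun setT (stat_tail x).
Proof.
by apply: measurable_funD; apply: measurableT_comp => //;
  apply: measurable_funB => //; apply: measurable_funM => //;
  exact: noise_stat_measurable.
Qed.

Lemma noise_tail_measurable : measurable_fun setT noise_tail.
Proof. by apply: measurable_sum_in => x _; exact: stat_tail_measurable. Qed.

(** There are [2 N^2 + N] statistics, each contributing at most [2 N^-6]. *)
Lemma noise_tail_integral : (\int[P]_w (noise_tail w)%:E <= (N^-1)%:E)%E.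
Proof.
have n0 := N_gt1; have Np : 0 < N by lra.
under eq_integral do rewrite -sumEFin.
rewrite ge0_integral_sum//; last 2 first.
- by move=> x; apply/measurable_EFinP; exact: stat_tail_measurable.
- by move=> x w _; rewrite lee_fin stat_tail_ge0.
apply: (@le_trans _ _ (\sum_(x : stat_index) (2 * expR (- (6 * ln N)))%:E)%E).
  by apply: lee_sum => x _; exact: stat_tail_integral.
rewrite sumEFin lee_fin sumr_const card_sum !card_prod card_option card_ord.
rewrite expRN expRM_natl lnK ?posrE// -[leLHS]mulr_natl natrD !natrM -natr1 -/N.
rewrite -(@ler_pM2r _ (N ^+ 6)) ?exprn_gt0//.
rewrite (_ : ((N + 1) * N + N * N) * (2 / N ^+ 6) * N ^+ 6 =
  2 * ((N + 1) * N + N * N)); last by field; lra.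
rewrite (_ : N^-1 * N ^+ 6 = N ^+ 5); last by field; lra.
have N2 : 2 <= N by rewrite ler_nat.
have N3 : 8 <= N ^+ 3.
  have N4 : 4 <= N ^+ 2 by rewrite expr2; nra.
  by rewrite exprS; nra.
have NN : 0 <= N ^+ 2 by exact: sqr_ge0.
have : 8 * N ^+ 2 <= N ^+ 3 * N ^+ 2 by rewrite ler_wpM2r.
by rewrite -exprD /=; nra.
Qed.

Lemma noise_tail_lt1 w x : noise_tail w < 1 ->
  `|noise_stat x w| <= 16 * Num.sqrt (N * ln N).
Proof.
move=> W1; set q := Num.sqrt _.
have c0 : 0 <= chernoff by rewrite divr_ge0 ?sqrtr_ge0.
have tail1 : stat_tail x w < 1.
  apply: le_lt_trans W1; rewrite /noise_tail (bigD1 x)//= lerDl.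
  by apply: sumr_ge0 => y _; exact: stat_tail_ge0.
have small t : expR (t * noise_stat x w - 8 * ln N) < 1 -> t * noise_stat x w < 8 * ln N.
  by rewrite -expR0 ltr_expR subr_lt0.
have e1 := expR_ge0 (chernoff * noise_stat x w - 8 * ln N).
have e2 := expR_ge0 (- chernoff * noise_stat x w - 8 * ln N).
have h1 : chernoff * noise_stat x w < 8 * ln N.
  by apply: small; rewrite /stat_tail in tail1; lra.
have h2 : - chernoff * noise_stat x w < 8 * ln N.
  by apply: small; rewrite /stat_tail in tail1; lra.
rewrite -chernoff_threshold -/q in h1 h2.
rewrite leNgt; apply/negP => big.
have : chernoff * (16 * q) <= chernoff * `|noise_stat x w|.
  by rewrite ler_wpM2l// ltW.
have /orP[s0|s0] := le_total 0 (noise_stat x w);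
  rewrite ?(ger0_norm s0) ?(ler0_norm s0) => ?; lra.
Qed.

End NoiseStatistics.

(** * Rates, constants and the final bound *)

Lemma powR_quarter (R : realType) (x : R) : 0 <= x ->
  x `^ (1 / 4) = Num.sqrt (Num.sqrt x).
Proof.
move=> x0; rewrite (_ : 1 / 4 = 2^-1 * 2^-1); last by field.
by rewrite powRrM !powR12_sqrt ?sqrtr_ge0.
Qed.

Lemma rate_factor (R : realType) (N l A : R) : 0 <= N -> 0 <= l ->
  Num.sqrt N * (A + Num.sqrt A * (N * l) `^ (1 / 4)) =
  A * Num.sqrt N + Num.sqrt A * N `^ (3 / 4) * l `^ (1 / 4).
Proof.
move=> N0 l0; rewrite powRM// mulrDr [Num.sqrt N * A]mulrC; congr (_ + _).
have -> : N `^ (3 / 4) = Num.sqrt N * N `^ (1 / 4).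
  rewrite -powR12_sqrt// -powRD; first by congr (_ `^ _); field.
  by apply/implyP => /eqP h; exfalso; lra.
by ring.
Qed.

(** With [alpha <= 3 / 2], [rho1 + eps] is at most [233 B] and [alpha * (1 + alpha)] at most
    [7 / 2], for a total of [1632 s B]. The summand [A] is the cost of the exceptional event. *)
Lemma pines_constant (R : realType) (A B s : R)
    (alpha := Num.sqrt 2 : R) (delta := Num.sqrt 2 * A) (eps := 20 * B)
    (rho1 := alpha ^+ 2 * delta + (2 * alpha ^+ 2 + 3 * alpha + 2) * eps) :
  0 <= A -> A <= B -> 1 <= s ->
  2 * s * (alpha * (1 + alpha) * (rho1 + eps)) + A <= 2000 * (s * B).
Proof.
move=> A0 AB s1.
have a2 : alpha ^+ 2 = 2 by rewrite sqr_sqrtr.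
have a0 : 0 <= alpha := sqrtr_ge0 _.
have a32 : alpha <= 3 / 2.
  by rewrite -(@ler_pXn2r _ 2) ?nnegrE// a2; lra.
have B0 : 0 <= B by exact: le_trans AB.
have r1 : rho1 + eps <= 233 * B.
  rewrite /rho1 /delta /eps -/alpha a2.
  have : alpha * A <= 3 / 2 * B by apply: ler_pM.
  have : alpha * B <= 3 / 2 * B by rewrite ler_wpM2r.
  by move=> ? ?; lra.
have r0 : 0 <= rho1 + eps.
  by rewrite /rho1 /eps /delta -/alpha a2 !(addr_ge0, mulr_ge0)//; lra.
have k : alpha * (1 + alpha) <= 7 / 2 by rewrite mulrDr mulr1 -expr2 a2; lra.
have k0 : 0 <= alpha * (1 + alpha) by rewrite mulr_ge0// addr_ge0.
have : alpha * (1 + alpha) * (rho1 + eps) <= 7 / 2 * (233 * B) by apply: ler_pM.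
set K := alpha * (1 + alpha) * (rho1 + eps) => KB.
have sB : 2 * s * K <= 2 * s * (7 / 2 * (233 * B)) by rewrite ler_wpM2l//; lra.
have AsB : A <= s * B by apply: le_trans AB _; rewrite ler_peMl.
have sB0 : 0 <= s * B by rewrite mulr_ge0//; lra.
apply: le_trans (lerD sB AsB) _.
by rewrite (_ : _ + _ = 1632 * (s * B)); [lra|field].
Qed.

Lemma dhat_sym (R : realType) (n : nat) (c1 A : R) (Y : 'M[R]_n) i j :
  dhat c1 A Y i j = dhat c1 A Y j i.
Proof.
rewrite !mxE eq_sym; case: ifP => // _.
by rewrite [self_inner _ _ _ i + _]addrC row_innerC.
Qed.

Lemma dhat_diag (R : realType) (n : nat) (c1 A : R) (Y : 'M[R]_n) i :
  dhat c1 A Y i i = 0.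
Proof. by rewrite mxE eqxx. Qed.

Theorem theorem4 (R : realType) :
  exists c1 c2 C : R, [/\ 0 < c1, 0 < c2, 0 < C &
  forall (n : nat) (A : R) (theta : n.-tuple R) (pistar : {perm 'I_n})
    (d : measure_display) (T : measurableType d) (P : probability T R)
    (E : 'I_n -> 'I_n -> {RV P >-> R})
    (pi0 : {perm 'I_n}) (rule : 'M[R]_n -> {perm 'I_n}),
  let X := perm_act pistar (toeplitz theta) in
  let Y := fun w : T => X + \matrix_(i, j) E i j w in
  let L := n%:R * ln n%:R in
  let alpha := Num.sqrt 2 in
  let delta := Num.sqrt 2 * A in
  let eps := c2 * (A + Num.sqrt A * L `^ (1 / 4)) in
  let rho3 := delta + eps in
  let rho2 := alpha * delta + 2 * (1 + alpha) * eps in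
  let rho1 := alpha ^+ 2 * delta + (2 * alpha ^+ 2 + 3 * alpha + 2) * eps in
  (2 <= n)%N -> 1 <= A ->
  (forall i : 'I_n, 0 <= tnth theta i <= A) ->
  (forall i j : 'I_n, (i <= j)%N -> tnth theta j <= tnth theta i) ->
  mutually_independent (fun ij : 'I_n * 'I_n => E ij.1 ij.2) ->
  (forall i j, centered (E i j)) ->
  (forall i j, subgaussian1 (E i j)) ->
  (forall y : 'M[R]_n,
     pines (dhat c1 A y) rho1 rho2 rho3 pi0 (rule (dhat c1 A y))) ->
  (forall s : {perm 'I_n}, mx_measurable (rule @^-1` [set s])%classic) ->
  ('E_P[fun w => ell2 X (rule (dhat c1 A (Y w)))] <=
     (C * (A * Num.sqrt n%:R
           + Num.sqrt A * n%:R `^ (3 / 4) * (ln n%:R) `^ (1 / 4)))%:E)%E].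
Proof.
exists 32, 20, 2000; split; rewrite ?ltr0n//.
move=> n A theta pistar d T P E pi0 rule X Y L alpha delta
  eps rho3 rho2 rho1 n2 A1 bounds anti indep _ sub runs _.
have A0 : 0 <= A := le_trans ler01 A1.
have N0 : 0 <= n%:R :> R := ler0n _ _.
have N1 : 1 <= n%:R :> R by rewrite ler1n ltnW.
have l0 : 0 <= ln n%:R :> R by rewrite ln_ge0.
have L0 : 0 <= L by rewrite mulr_ge0.
pose q := Num.sqrt L.
have q0 : 0 <= q := sqrtr_ge0 _.
have LE : L `^ (1 / 4) = Num.sqrt q by rewrite powR_quarter.
pose a (r : option 'I_n) k := if r is Some i then X i k / A else 1.
have XA := signal_bounds pistar A0 bounds.
have a1 r k : `|a r k| <= 1.
  case: r => [i|] /=; last by rewrite normr1.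
  have /andP[x0 xA] := XA i k.
  by rewrite ger0_norm ?divr_ge0// ler_pdivrMr ?mul1r// (lt_le_trans ltr01).
pose W := noise_tail E a.
pose K := 2 * Num.sqrt n%:R * (alpha * (1 + alpha) * (rho1 + eps)).
have eps0 : 0 <= eps.
  by rewrite mulr_ge0// addr_ge0// mulr_ge0 ?sqrtr_ge0// powR_ge0.
have K0 : 0 <= K.
  have alpha0 : 0 <= alpha := sqrtr_ge0 _.
  have delta0 : 0 <= delta := mulr_ge0 alpha0 A0.
  have rho0 : 0 <= rho1.
    apply: addr_ge0; apply: mulr_ge0 => //; first exact: exprn_ge0.
    by rewrite addr_ge0// addr_ge0// mulr_ge0// exprn_ge0.
  apply: mulr_ge0; first by rewrite mulr_ge0// sqrtr_ge0.
  by apply: mulr_ge0; [apply: mulr_ge0|]; rewrite // addr_ge0.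
(* If [W w < 1], all noise statistics obey their threshold and the deterministic analysis
   applies. *)
have good w : W w < 1 -> ell2 X (rule (dhat 32 A (Y w))) <= K.
  move=> W1; have noise x := noise_tail_lt1 n2 x W1.
  pose Ew := \matrix_(i, j) E i j w.
  have EwE i j : Ew i j = E i j w by rewrite mxE.
  apply: (pines_ell2 A0 bounds anti _ _ _ eps0 (runs (Y w))).
  - exact: dhat_sym.
  - exact: dhat_diag.
  move=> i j; rewrite /eps LE.
  apply: (dhat_close (q := q) (E := Ew)) => //.
  - by move=> k; exact: (signal_near pistar A0 bounds anti).
  - by move=> k l; exact: (signal_sqr_total pistar A0 bounds anti).
  - move=> k; rewrite /row_total (eq_bigr (fun j => 1 * E k j w)).
      exact: noise (inl (None, k)).
    by move=> l _; rewrite EwE mul1r.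
  (* The statistic was normalised by [A], which is multiplied back here. *)
  - move=> k l; have := noise (inl (Some k, l)); rewrite /=.
    under eq_bigr do rewrite mulrAC.
    have A_gt0 : 0 < A := lt_le_trans ltr01 A1.
    rewrite -mulr_suml normrM normfV (ger0_norm A0) ler_pdivrMr// => le.
    rewrite [16 * A * q]mulrAC; under eq_bigr do rewrite EwE.
    exact: le.
  - move=> k l kl; have := noise (inr (k, l)); rewrite /= (negbTE kl) /row_inner.
    by under [X in _ -> `|X| <= _]eq_bigr do rewrite !EwE.
(* Where [W w >= 1], the trivial bound [n A] is absorbed by [n A W]. *)
have bound w : ell2 X (rule (dhat 32 A (Y w))) <= K + n%:R * A * W w.
  have W0 : 0 <= W w := noise_tail_ge0 _ _ _.
  have nA : 0 <= n%:R * A by rewrite mulr_ge0.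
  have [W1|W1] := ltP (W w) 1.
    by apply: le_trans (good w W1) _; rewrite lerDl mulr_ge0.
  apply: le_trans (ell2_le_max _ A0 XA) _.
  by rewrite -[leLHS]add0r lerD// ler_peMr.
rewrite unlock.
apply: (@le_trans _ _ (\int[P]_w (K + n%:R * A * W w)%:E)%E).
  by apply: le_integral_nonmeasurable => w; rewrite lee_fin// ell2_ge0.
apply: (le_trans (integral_affine_le _ _ _ _ (noise_tail_integral indep sub n2 a1))).
- exact: K0.
- by rewrite mulr_ge0.
- by move=> w; exact: noise_tail_ge0.
- exact: noise_tail_measurable.
have n_neq0 : n%:R != 0 :> R by rewrite gt_eqF// (lt_le_trans ltr01).
(* The mean of [W] is at most [1 / n], so the exceptional part costs only [A]. *)
rewrite lee_fin (_ : n%:R * A * n%:R^-1 = A); last by field.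
rewrite -(rate_factor A N0 l0); apply: pines_constant => //.
- by rewrite lerDl mulr_ge0 ?sqrtr_ge0 ?powR_ge0.
- by rewrite -[leLHS]sqrtr1 ler_sqrt.
Qed.
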